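(* Let $n\ge 2$ be an integer and let $d_n\ge 0$ be defined by \[ d_n^2:=\min_{\lambda_2,\dots,\lambda_n\in\mathbb{R}}\int_0^1\Bigl(1-\sum_{k=2}^n\lambda_kf_k(x)\Bigr)^2\,dx . \] Then the Riemann zeta function $\zeta(s)$ has no zeros in the set $\{s\in\mathbb{C}:\ \Re s>(1+d_n|s|^2)/2\}$.
   Context: For each integer $k\ge2$, $f_k:(0,1]\to\mathbb{R}$ is defined by $f_k(x):=\frac{1}{k}\bigl[\frac{1}{x}\bigr]-\bigl[\frac{1}{kx}\bigr]$, where $[t]$ denotes the integer part of $t$. Here $\zeta$ denotes the Riemann zeta function, i.e. the meromorphic continuation to $\mathbb{C}$ (holomorphic on $\mathbb{C}\setminus\{1\}$) of $\sum_{k\ge1}k^{-s}$, $\Re s>1$. *)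

(* Defs.v *)
From Stdlib Require Import Reals.
From Coquelicot Require Import Coquelicot.

Open Scope R_scope.

(* [Int_part] is the floor function, with values in [Z]. *)
Definition fk (k : nat) (x : R) : R :=
  / INR k * IZR (Int_part (/ x)) - IZR (Int_part (/ (INR k * x))).

(* Only the values of [fk k] on (0,1] matter: the value at the endpoint 0 does
   not affect a Riemann integral.  Each [fk k] is bounded and has countably many
   discontinuities on (0,1], so the integral below exists in Riemann's sense
   and agrees with the Lebesgue integral. *)
Definition sq_dist (n : nat) (lambda : nat -> R) : R :=
  RInt (fun x => (1 - sum_n_m (fun k => lambda k * fk k x) 2 n) ^ 2) 0 1.

(* [m] is the minimum of [F], attained.  The coefficients are given as a whole
   sequence [lambda], of which [sq_dist n] only reads the indices 2, ..., n. *)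
Definition is_min_value {T : Type} (F : T -> R) (m : R) : Prop :=
  (exists t, F t = m) /\ (forall t, m <= F t).

Definition Cexp (z : C) : C := (exp (Re z) * cos (Im z), exp (Re z) * sin (Im z)).

(* x ^ (-s) for real x > 0, with the real logarithm of x. *)
Definition pow_neg (x : R) (s : C) : C := Cexp (- s * RtoC (ln x))%C.

Definition C_differentiable_at (g : C -> C) (z : C) : Prop :=
  @ex_derive C_AbsRing C_NormedModule g z.

(* Near [p], off [p] itself, g w = h w / (w - p)^m with h holomorphic near [p];
   the value [g p] is unconstrained. *)
Definition meromorphic_at (g : C -> C) (p : C) : Prop :=
  exists (m : nat) (h : C -> C),
    locally p (fun w : C => C_differentiable_at h w) /\
    locally p (fun w : C => w <> p -> g w = (h w / Cpow (w - p) m)%C).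

(* This determines [zeta] on C \ {1} by the identity theorem; its value at the
   pole 1 is unconstrained.  The series is indexed from j = 0, with base j + 1. *)
Record is_riemann_zeta (zeta : C -> C) : Prop := {
  zeta_meromorphic : forall p : C, meromorphic_at zeta p;
  zeta_holomorphic : forall s : C, s <> RtoC 1 -> C_differentiable_at zeta s;
  zeta_series : forall s : C, 1 < Re s ->
    @is_series C_AbsRing C_NormedModule
      (fun j : nat => pow_neg (INR (S j)) s) (zeta s)
}.

(* The pole 1 is not a zero, whatever value is assigned there. *)
Definition is_zero_of_zeta (zeta : C -> C) (s : C) : Prop :=
  s <> RtoC 1 /\ zeta s = RtoC 0.

(* Main.v *)
Require Import Defs.
From Stdlib Require Import Reals Lra Lia Classical ClassicalEpsilon.
From Coquelicot Require Import Coquelicot.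
Open Scope R_scope.

(** On (1/(m+1), 1/m) the function f_k is the constant c_(k,m) = m/k - [m/k], so
    with t_m(s) = m^(-s) - (m+1)^(-s) its Mellin transform is, up to the factor s,
    D_k(s) = sum_m c_(k,m) t_m(s), which converges for Re s > 0.  For Re s > 1,
    Abel summation gives D_k(s) = (1/k - k^(-s)) zeta(s); by unique continuation
    this persists for Re s > 0, so D_k(s) = 0 for every k at a zero s.  If g_m are
    the values of 1 - sum_k lambda_k f_k for the optimal lambda, then
    1 = sum_m g_m t_m(s), and Cauchy-Schwarz (in its arithmetic-geometric form)
    yields 2 Re s - 1 <= d^2 |s|^2 <= d |s|^2, since d <= 1 (take lambda = 0).

    Unique continuation needs no Cauchy formula: Goursat's lemma provides a
    primitive H of h, vanishing where h does, and this H is twice differentiable.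
    Where H does not vanish ln |H|^2 is harmonic, so |H|^2 times the exponential of
    a strictly subharmonic weight has no interior maximum; a weight that is larger
    at the given point than on the part of a rectangle's boundary where H may be
    nonzero, multiplied by a large constant, forces H = 0. *)

(** * Goursat's lemma *)

(** Complex differentiability alone gives no second derivatives of h; this is why the primitive H is
    needed. Its partial derivatives are, up to sign, Re h and Im h, which are differentiable at
    every point, and the pointwise second derivative test asks for no more. The weight is lam exp (2
    a (x - x0)) cos (a (y - y0)): its Laplacian is 3 a^2 times itself, its cosine vanishes on the
    horizontal sides of the rectangle, and its exponential is smaller on the left side than at x0;
    on the right side H is 0. Working in horizontal strips off the real axis keeps the pole at 1
    away.

    On the Dirichlet side everything is written in the variable y = ln (1/x), where each term is an
    increment of an exponential. Convergence, holomorphy in s and the final estimate then all come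
    from one mean value inequality, with majorants that telescope. The arithmetic-geometric form of
    Cauchy-Schwarz applies term by term to partial sums, so no improper Mellin integral has to be
    formed. *)

Lemma nested_intervals_point (a b : nat -> R) :
  (forall n, a n <= a (S n)) -> (forall n, b (S n) <= b n) ->
  (forall n, a n <= b n) -> exists u, forall n, a n <= u <= b n.
Proof.
intros Ha Hb Hab.
assert (Ma : forall n k, a n <= a (n + k)%nat).
{ intros n. induction k as [ | k IH]; [rewrite Nat.add_0_r; lra | ].
  rewrite Nat.add_succ_r. specialize (Ha (n + k)%nat). lra. }
assert (Mb : forall n k, b (n + k)%nat <= b n).
{ intros n. induction k as [ | k IH]; [rewrite Nat.add_0_r; lra | ].
  rewrite Nat.add_succ_r. specialize (Hb (n + k)%nat). lra. }
assert (Mab : forall n m, a n <= b m).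
{ intros n m. apply Rle_trans with (1 := Ma n m).
  apply Rle_trans with (1 := Hab _). rewrite Nat.add_comm. apply Mb. }
destruct (completeness (fun x => exists n, x = a n)) as [u [Hu1 Hu2]].
- exists (b O). intros x [n ->]. apply Mab.
- now exists (a O), O.
- exists u. intros n. split.
  + apply Hu1. now exists n.
  + apply Hu2. intros x [m ->]. apply Mab.
Qed.

(** Bisection as an induction principle; [P x y r] speaks of the rectangle with lower left corner
    (x, y) and sides r W, r H. If [P] failed at scale 1, failing quarters would shrink to a point
    (u, v), against the local hypothesis there. Both compactness and Goursat's lemma are
    instances. *)
Lemma rectangle_induction (x0 y0 W H : R) (P : R -> R -> R -> Prop) :
  0 < W -> 0 < H ->
  (forall x y r, 0 < r -> P x y (r / 2) -> P (x + r / 2 * W) y (r / 2) ->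
     P x (y + r / 2 * H) (r / 2) -> P (x + r / 2 * W) (y + r / 2 * H) (r / 2) ->
     x0 <= x -> x + r * W <= x0 + W -> y0 <= y -> y + r * H <= y0 + H ->
     P x y r) ->
  (forall u v, x0 <= u <= x0 + W -> y0 <= v <= y0 + H ->
     exists del : posreal, forall x y r, 0 < r -> r * W < del -> r * H < del ->
       x0 <= x -> x + r * W <= x0 + W -> y0 <= y -> y + r * H <= y0 + H ->
       x <= u <= x + r * W -> y <= v <= y + r * H -> P x y r) ->
  P x0 y0 1.
Proof.
intros HW HH Hquad Hloc. apply NNPP. intro N0.
pose (r := fun n => (/ 2) ^ n).
assert (Hr : forall n, 0 < r n) by (intro; apply pow_lt; lra).
assert (HrS : forall n, r (S n) = r n / 2) by (intro; unfold r; simpl; field).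
assert (HrW : forall n, 0 < r n * W) by (intro; now apply Rmult_lt_0_compat).
assert (HrH : forall n, 0 < r n * H) by (intro; now apply Rmult_lt_0_compat).
pose (inside := fun n (p : R * R) => x0 <= fst p /\ fst p + r n * W <= x0 + W /\
  y0 <= snd p /\ snd p + r n * H <= y0 + H).
pose (bad := fun n (p : R * R) => ~ P (fst p) (snd p) (r n) /\ inside n p).
pose (nested := fun n (p p' : R * R) => fst p <= fst p' <= fst p + r n / 2 * W /\
  snd p <= snd p' <= snd p + r n / 2 * H).
(* The existential stands outside the implication so that choice yields a total function [nxt]. *)
assert (Hstep : forall n p, exists p', bad n p -> bad (S n) p' /\ nested n p p').
{ intros n p. apply NNPP. intro N.
  assert (Nb : forall p', ~ (bad n p -> bad (S n) p' /\ nested n p p')).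
  { intros p' A. apply N. now exists p'. }
  destruct (classic (bad n p)) as [[B1 (B2 & B3 & B4 & B5)] | NB];
    [ | apply (Nb p); tauto].
  destruct p as [x y]. simpl in *.
  specialize (HrW n). specialize (HrH n).
  assert (G : forall x' y', x <= x' <= x + r n / 2 * W ->
    y <= y' <= y + r n / 2 * H -> P x' y' (r n / 2)).
  { intros x' y' A C. apply NNPP. intro D. apply (Nb (x', y')).
    intros _. unfold bad, inside, nested; simpl fst; simpl snd; rewrite HrS.
    repeat split; try assumption; lra. }
  apply B1, Hquad; try assumption; [apply Hr | | | | ]; apply G; lra. }
pose (nxt := fun n p => proj1_sig (constructive_indefinite_description _ (Hstep n p))).
assert (Hnxt : forall n p, bad n p -> bad (S n) (nxt n p) /\ nested n p (nxt n p)).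
{ intros n p. unfold nxt. now destruct constructive_indefinite_description. }
pose (z := fix z n := match n with O => (x0, y0) | S m => nxt m (z m) end).
assert (Hz : forall n, bad n (z n)).
{ induction n as [ | n IH].
  - unfold bad, inside, r; simpl. split; [exact N0 | lra].
  - now apply Hnxt. }
assert (Hnest : forall n, nested n (z n) (z (S n))).
{ intros n. now apply Hnxt. }
destruct (nested_intervals_point (fun n => fst (z n)) (fun n => fst (z n) + r n * W))
  as [u Hu].
{ intros n. now apply Hnest. }
{ intros n. rewrite HrS. destruct (Hnest n) as [A _]. lra. }
{ intros n. specialize (HrW n). lra. }
destruct (nested_intervals_point (fun n => snd (z n)) (fun n => snd (z n) + r n * H))
  as [v Hv].
{ intros n. now apply Hnest. }
{ intros n. rewrite HrS. destruct (Hnest n) as [_ A]. lra. }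
{ intros n. specialize (HrH n). lra. }
destruct (Hloc u v) as [d Hd].
{ specialize (Hu O). unfold r in Hu; simpl in Hu. lra. }
{ specialize (Hv O). unfold r in Hv; simpl in Hv. lra. }
assert (Hmu : 0 < d / (W + H)).
{ apply Rdiv_lt_0_compat; [apply cond_pos | lra]. }
destruct (pow_lt_1_zero (/ 2) ltac:(rewrite Rabs_right; lra) _ Hmu) as [n Hn].
specialize (Hn n (Nat.le_refl n)). fold (r n) in Hn.
specialize (Hr n). specialize (HrW n). specialize (HrH n).
rewrite Rabs_right in Hn by lra.
apply (Rmult_lt_compat_r (W + H)) in Hn; [ | lra].
unfold Rdiv in Hn. rewrite Rmult_assoc, Rinv_l, Rmult_1_r in Hn by lra.
destruct (Hz n) as [Nz (Z1 & Z2 & Z3 & Z4)].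
apply Nz. apply Hd; auto; lra.
Qed.

(** Without a maximum every value is exceeded by some [G p q], which by continuity also exceeds all
    nearby values. Being dominated by a single value of [G] passes from the quarters to the whole,
    so some value of [G] would exceed itself. *)
Lemma rectangle_max (x1 x2 y1 y2 : R) (G : R -> R -> R) :
  x1 < x2 -> y1 < y2 ->
  (forall x y, x1 <= x <= x2 -> y1 <= y <= y2 -> continuity_2d_pt G x y) ->
  exists p q, x1 <= p <= x2 /\ y1 <= q <= y2 /\
    forall x y, x1 <= x <= x2 -> y1 <= y <= y2 -> G x y <= G p q.
Proof.
intros Hx Hy Hc. apply NNPP. intro N.
assert (Hup : forall u v, x1 <= u <= x2 -> y1 <= v <= y2 ->
  exists p q, x1 <= p <= x2 /\ y1 <= q <= y2 /\ G u v < G p q).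
{ intros u v Hu Hv. apply NNPP. intro M. apply N. exists u, v.
  split; [exact Hu | split; [exact Hv | ]]. intros x y A B.
  apply Rnot_lt_le. intro L. apply M. now exists x, y. }
pose (P := fun x y r => exists p q, x1 <= p <= x2 /\ y1 <= q <= y2 /\
  forall s t, x <= s <= x + r * (x2 - x1) -> y <= t <= y + r * (y2 - y1) ->
    G s t < G p q).
assert (HP : P x1 y1 1).
{ apply (rectangle_induction x1 y1 (x2 - x1) (y2 - y1)); try lra.
  - intros x y r Hr (p1 & q1 & A1 & B1 & C1) (p2 & q2 & A2 & B2 & C2)
      (p3 & q3 & A3 & B3 & C3) (p4 & q4 & A4 & B4 & C4) _ _ _ _.
    assert (E : exists p q, x1 <= p <= x2 /\ y1 <= q <= y2 /\
      G p1 q1 <= G p q /\ G p2 q2 <= G p q /\ G p3 q3 <= G p q /\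
      G p4 q4 <= G p q).
    { destruct (Rle_dec (G p1 q1) (G p2 q2)); destruct (Rle_dec (G p3 q3) (G p4 q4)).
      - destruct (Rle_dec (G p2 q2) (G p4 q4)); [exists p4, q4 | exists p2, q2]; repeat split; lra.
      - destruct (Rle_dec (G p2 q2) (G p3 q3)); [exists p3, q3 | exists p2, q2]; repeat split; lra.
      - destruct (Rle_dec (G p1 q1) (G p4 q4)); [exists p4, q4 | exists p1, q1]; repeat split; lra.
      - destruct (Rle_dec (G p1 q1) (G p3 q3)); [exists p3, q3 | exists p1, q1]; repeat split; lra. }
    destruct E as (p & q & Ap & Bq & L1 & L2 & L3 & L4).
    exists p, q. split; [exact Ap | split; [exact Bq | ]].
    intros s t Hs Ht.
    destruct (Rle_dec s (x + r / 2 * (x2 - x1)));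
    destruct (Rle_dec t (y + r / 2 * (y2 - y1))).
    + apply Rlt_le_trans with (2 := L1). apply C1; lra.
    + apply Rlt_le_trans with (2 := L3). apply C3; lra.
    + apply Rlt_le_trans with (2 := L2). apply C2; lra.
    + apply Rlt_le_trans with (2 := L4). apply C4; lra.
  - intros u v Hu Hv.
    destruct (Hup u v) as (p & q & Ap & Bq & L); [lra | lra | ].
    destruct (Hc u v ltac:(lra) ltac:(lra) (mkposreal (G p q - G u v) ltac:(lra)))
      as [del Hdel].
    exists del. intros x y r Hr I1 I2 _ _ _ _ I3 I4.
    exists p, q. split; [exact Ap | split; [exact Bq | ]].
    intros s t Hs Ht.
    assert (K : Rabs (G s t - G u v) < G p q - G u v).
    { apply Hdel; apply Rabs_def1; lra. }
    apply Rabs_def2 in K. lra. }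
destruct HP as (p & q & Ap & Bq & L).
apply (Rlt_irrefl (G p q)). apply L; lra.
Qed.

Lemma continuity_2d_pt_x (P : R -> R -> R) (x y : R) :
  continuity_2d_pt P x y -> continuous (fun t => P t y) x.
Proof.
intros H. apply continuity_pt_filterlim.
intros eps Heps. destruct (H (mkposreal eps Heps)) as [del Hd].
exists del. split; [apply cond_pos | ]. intros t [_ Ht].
apply Hd; [exact Ht | rewrite Rminus_diag, Rabs_R0; apply cond_pos].
Qed.

Lemma continuity_2d_pt_y (P : R -> R -> R) (x y : R) :
  continuity_2d_pt P x y -> continuous (fun t => P x t) y.
Proof.
intros H. apply continuity_pt_filterlim.
intros eps Heps. destruct (H (mkposreal eps Heps)) as [del Hd].
exists del. split; [apply cond_pos | ]. intros t [_ Ht].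
apply Hd; [rewrite Rminus_diag, Rabs_R0; apply cond_pos | exact Ht].
Qed.

(** The counterclockwise integral of P dx + Q dy, with opposite sides of the rectangle combined
    under one integral sign. *)
Definition boundary_int (P Q : R -> R -> R) (x1 x2 y1 y2 : R) : R :=
  RInt (fun t => P t y1 - P t y2) x1 x2 + RInt (fun t => Q x2 t - Q x1 t) y1 y2.

(** The shared coefficient [b] says that P dx + Q dy is closed. As the partial derivatives are not
    assumed continuous, the argument is local: near a point the affine part of the form integrates
    to 0, its two contributions being -b and b times the area, and the remainder is a small multiple
    of the area. *)
Lemma goursat (P Q : R -> R -> R) (x1 x2 y1 y2 : R) :
  x1 < x2 -> y1 < y2 ->
  (forall x y, x1 <= x <= x2 -> y1 <= y <= y2 -> exists a b c,
     differentiable_pt_lim P x y a b /\ differentiable_pt_lim Q x y b c) ->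
  boundary_int P Q x1 x2 y1 y2 = 0.
Proof.
intros Hx Hy Hd.
assert (CP : forall x y, x1 <= x <= x2 -> y1 <= y <= y2 -> continuity_2d_pt P x y).
{ intros x y A B. destruct (Hd x y A B) as (a & b & c & D1 & _).
  apply differentiable_continuity_pt. now exists a, b. }
assert (CQ : forall x y, x1 <= x <= x2 -> y1 <= y <= y2 -> continuity_2d_pt Q x y).
{ intros x y A B. destruct (Hd x y A B) as (a & b & c & _ & D1).
  apply differentiable_continuity_pt. now exists b, c. }
assert (EP : forall y a b, y1 <= y <= y2 -> x1 <= a <= x2 -> x1 <= b <= x2 ->
  ex_RInt (fun t => P t y) a b).
{ intros y a b A B C. apply (ex_RInt_continuous (V := R_CompleteNormedModule)).
  intros z [Z1 Z2]. apply continuity_2d_pt_x, CP; [ | exact A].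
  split; [apply Rle_trans with (2 := Z1); apply Rmin_glb; lra
         | apply Rle_trans with (1 := Z2); apply Rmax_lub; lra]. }
assert (EQ : forall x a b, x1 <= x <= x2 -> y1 <= a <= y2 -> y1 <= b <= y2 ->
  ex_RInt (fun t => Q x t) a b).
{ intros x a b A B C. apply (ex_RInt_continuous (V := R_CompleteNormedModule)).
  intros z [Z1 Z2]. apply continuity_2d_pt_y, CQ; [exact A | ].
  split; [apply Rle_trans with (2 := Z1); apply Rmin_glb; lra
         | apply Rle_trans with (1 := Z2); apply Rmax_lub; lra]. }
assert (EPd : forall y y' a b, y1 <= y <= y2 -> y1 <= y' <= y2 ->
  x1 <= a <= x2 -> x1 <= b <= x2 -> ex_RInt (fun t => P t y - P t y') a b).
{ intros. apply (ex_RInt_minus (V := R_NormedModule)); apply EP; assumption. }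
assert (EQd : forall x x' a b, x1 <= x <= x2 -> x1 <= x' <= x2 ->
  y1 <= a <= y2 -> y1 <= b <= y2 -> ex_RInt (fun t => Q x t - Q x' t) a b).
{ intros. apply (ex_RInt_minus (V := R_NormedModule)); apply EQ; assumption. }
assert (SplitX : forall a m b c d, x1 <= a -> a <= m -> m <= b -> b <= x2 ->
  y1 <= c -> c <= d -> d <= y2 ->
  boundary_int P Q a b c d = boundary_int P Q a m c d + boundary_int P Q m b c d).
{ intros a m b c d I1 I2 I3 I4 I5 I6 I7. unfold boundary_int.
  rewrite <- (RInt_Chasles (V := R_CompleteNormedModule)
    (fun t => P t c - P t d) a m b) by (apply EPd; lra).
  replace (RInt (fun t => Q b t - Q a t) c d) with
    (RInt (fun t => Q m t - Q a t) c d + RInt (fun t => Q b t - Q m t) c d).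
  { unfold plus; simpl. ring. }
  rewrite <- (RInt_plus (V := R_CompleteNormedModule)) by (apply EQd; lra).
  apply RInt_ext. intros t _. unfold plus; simpl. ring. }
assert (SplitY : forall a b c m d, x1 <= a -> a <= b -> b <= x2 ->
  y1 <= c -> c <= m -> m <= d -> d <= y2 ->
  boundary_int P Q a b c d = boundary_int P Q a b c m + boundary_int P Q a b m d).
{ intros a b c m d I1 I2 I3 I4 I5 I6 I7. unfold boundary_int.
  rewrite <- (RInt_Chasles (V := R_CompleteNormedModule)
    (fun t => Q b t - Q a t) c m d) by (apply EQd; lra).
  replace (RInt (fun t => P t c - P t d) a b) with
    (RInt (fun t => P t c - P t m) a b + RInt (fun t => P t m - P t d) a b).
  { unfold plus; simpl. ring. }
  rewrite <- (RInt_plus (V := R_CompleteNormedModule)) by (apply EPd; lra).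
  apply RInt_ext. intros t _. unfold plus; simpl. ring. }
set (W := x2 - x1). set (H := y2 - y1).
assert (HW : 0 < W) by (unfold W; lra). assert (HH : 0 < H) by (unfold H; lra).
assert (Hall : forall eps, 0 < eps ->
  Rabs (boundary_int P Q x1 x2 y1 y2) <= eps).
{ intros eps Heps.
  (* The bound scales like the area, so the bounds of four quarters add up exactly to the bound of
     the whole. *)
  pose (T := fun x y r =>
    Rabs (boundary_int P Q x (x + r * W) y (y + r * H)) <= eps * r ^ 2).
  assert (HT : T x1 y1 1).
  { apply (rectangle_induction x1 y1 W H); try assumption.
    - intros x y r Hr T1 T2 T3 T4 A B C D. unfold T in *.
      assert (0 < r * W) by now apply Rmult_lt_0_compat.
      assert (0 < r * H) by now apply Rmult_lt_0_compat.
      unfold W, H in A, B, C, D.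
      rewrite (SplitX x (x + r / 2 * W) (x + r * W)) by (unfold W, H in *; lra).
      rewrite (SplitY x _ y (y + r / 2 * H) (y + r * H)) by (unfold W, H in *; lra).
      rewrite (SplitY (x + r / 2 * W) _ y (y + r / 2 * H) (y + r * H))
        by (unfold W, H in *; lra).
      replace (x + r / 2 * W + r / 2 * W) with (x + r * W) in * by field.
      replace (y + r / 2 * H + r / 2 * H) with (y + r * H) in * by field.
      replace (eps * r ^ 2) with
        ((eps * (r / 2) ^ 2 + eps * (r / 2) ^ 2) + (eps * (r / 2) ^ 2 + eps * (r / 2) ^ 2))
        by field.
      eapply Rle_trans; [apply Rabs_triang | ].
      apply Rplus_le_compat; (eapply Rle_trans; [apply Rabs_triang | lra]).
    - intros u v Hu Hv. unfold W, H in Hu, Hv.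
      destruct (Hd u v ltac:(lra) ltac:(lra)) as (a & b & c & DP & DQ).
      (* On each side the remainder is at most e (r W + r H). Two horizontal sides of length r W and
         two vertical ones of length r H make 2 e (r W + r H)^2, which is eps r^2 for this e. *)
      assert (He : 0 < eps / (2 * (W + H) ^ 2)).
      { apply Rdiv_lt_0_compat; [exact Heps | ].
        apply Rmult_lt_0_compat; [lra | apply pow_lt; lra]. }
      destruct (DP (mkposreal _ He)) as [del1 K1].
      destruct (DQ (mkposreal _ He)) as [del2 K2]. simpl in K1, K2.
      set (e := eps / (2 * (W + H) ^ 2)) in *.
      assert (Hmin : 0 < Rmin del1 del2) by (apply Rmin_pos; apply cond_pos).
      exists (mkposreal _ Hmin). simpl.
      intros x y r Hr I1 I2 J1 J2 J3 J4 I3 I4. unfold T.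
      assert (EW : x1 + W = x2) by (unfold W; ring).
      assert (EH : y1 + H = y2) by (unfold H; ring).
      assert (L1 := Rmin_l del1 del2). assert (L2 := Rmin_r del1 del2).
      assert (rW : 0 < r * W) by now apply Rmult_lt_0_compat.
      assert (rH : 0 < r * H) by now apply Rmult_lt_0_compat.
      assert (Ee : eps * r ^ 2 = 2 * e * (r * W + r * H) ^ 2).
      { unfold e. field. lra. }
      assert (Hm : forall s t, x <= s <= x + r * W -> y <= t <= y + r * H ->
        Rabs (s - u) < Rmin del1 del2 /\ Rabs (t - v) < Rmin del1 del2 /\
        e * Rmax (Rabs (s - u)) (Rabs (t - v)) <= e * (r * W + r * H)).
      { intros s t Hs Ht.
        split; [apply Rabs_def1; lra | split; [apply Rabs_def1; lra | ]].
        apply Rmult_le_compat_l; [lra | ].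
        apply Rmax_lub; apply Rabs_le; lra. }
      assert (BP : forall s t, x <= s <= x + r * W -> y <= t <= y + r * H ->
        Rabs (P s t - P u v - (a * (s - u) + b * (t - v))) <= e * (r * W + r * H)).
      { intros s t Hs Ht. destruct (Hm s t Hs Ht) as (M1 & M2 & M3).
        apply Rle_trans with (2 := M3). apply K1; lra. }
      assert (BQ : forall s t, x <= s <= x + r * W -> y <= t <= y + r * H ->
        Rabs (Q s t - Q u v - (b * (s - u) + c * (t - v))) <= e * (r * W + r * H)).
      { intros s t Hs Ht. destruct (Hm s t Hs Ht) as (M1 & M2 & M3).
        apply Rle_trans with (2 := M3). apply K2; lra. }
      assert (IP : Rabs (RInt (fun t => P t y - P t (y + r * H)) x (x + r * W)
        - r * W * (- b * (r * H))) <= r * W * (2 * e * (r * W + r * H))).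
      { replace (r * W * (- b * (r * H))) with
          (RInt (fun _ => - b * (r * H)) x (x + r * W)).
        2: { rewrite RInt_const. unfold scal; simpl; unfold mult; simpl. ring. }
        rewrite <- (RInt_minus (V := R_CompleteNormedModule));
          [ | apply EPd; lra | apply ex_RInt_const].
        replace (r * W * (2 * e * (r * W + r * H))) with
          ((x + r * W - x) * (2 * e * (r * W + r * H))) by ring.
        apply abs_RInt_le_const; [lra | | ].
        { apply (ex_RInt_minus (V := R_NormedModule)); [apply EPd; lra | apply ex_RInt_const]. }
        intros t Ht. unfold minus, plus, opp; simpl.
        assert (B1 := BP t y ltac:(lra) ltac:(lra)).
        assert (B2 := BP t (y + r * H) ltac:(lra) ltac:(lra)).
        apply Rabs_le_between in B1. apply Rabs_le_between in B2.
        apply Rabs_le. lra. }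
      assert (IQ : Rabs (RInt (fun t => Q (x + r * W) t - Q x t) y (y + r * H)
        - r * H * (b * (r * W))) <= r * H * (2 * e * (r * W + r * H))).
      { replace (r * H * (b * (r * W))) with
          (RInt (fun _ => b * (r * W)) y (y + r * H)).
        2: { rewrite RInt_const. unfold scal; simpl; unfold mult; simpl. ring. }
        rewrite <- (RInt_minus (V := R_CompleteNormedModule));
          [ | apply EQd; lra | apply ex_RInt_const].
        replace (r * H * (2 * e * (r * W + r * H))) with
          ((y + r * H - y) * (2 * e * (r * W + r * H))) by ring.
        apply abs_RInt_le_const; [lra | | ].
        { apply (ex_RInt_minus (V := R_NormedModule)); [apply EQd; lra | apply ex_RInt_const]. }
        intros t Ht. unfold minus, plus, opp; simpl.
        assert (B1 := BQ x t ltac:(lra) ltac:(lra)).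
        assert (B2 := BQ (x + r * W) t ltac:(lra) ltac:(lra)).
        apply Rabs_le_between in B1. apply Rabs_le_between in B2.
        apply Rabs_le. lra. }
      rewrite Ee. unfold boundary_int.
      apply Rabs_le_between in IP. apply Rabs_le_between in IQ.
      apply Rabs_le. nra. }
  unfold T in HT. unfold W, H in HT.
  replace (x1 + 1 * (x2 - x1)) with x2 in HT by ring.
  replace (y1 + 1 * (y2 - y1)) with y2 in HT by ring. lra. }
destruct (Req_dec (boundary_int P Q x1 x2 y1 y2) 0) as [ | N]; [assumption | ].
apply Rabs_pos_lt in N.
specialize (Hall (Rabs (boundary_int P Q x1 x2 y1 y2) / 2) ltac:(lra)). lra.
Qed.

(** * Unique continuation *)

(** A split on the sign of [f1 p] takes the place of Fermat's f'(p) = 0. If c > 0, then f' exceeds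
    f'(p) just to the right of p and is below it just to the left; so f increases to the right when
    f'(p) >= 0, and decreases towards p from the left when f'(p) < 0. Either way p is no maximum. *)
Lemma second_derivative_test (f f1 : R -> R) (p c : R) :
  locally p (fun x => is_derive f x (f1 x)) -> is_derive f1 p c ->
  locally p (fun x => f x <= f p) -> c <= 0.
Proof.
intros [d1 H1] H2 [d3 H3]. apply Rnot_lt_le. intro Hc.
apply is_derive_Reals in H2.
destruct (H2 (c / 2) ltac:(lra)) as [d2 Hd2].
assert (Hsl : forall k, k <> 0 -> Rabs k < d2 -> 0 < (f1 (p + k) - f1 p) / k).
{ intros k Hk Hk2. specialize (Hd2 k Hk Hk2). apply Rabs_def2 in Hd2. lra. }
set (d := Rmin d1 (Rmin d2 d3)).
assert (Hd : 0 < d).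
{ unfold d. repeat apply Rmin_pos; apply cond_pos. }
assert (L1 : d <= d1) by apply Rmin_l.
assert (L2 : d <= d2) by (eapply Rle_trans; [apply Rmin_r | apply Rmin_l]).
assert (L3 : d <= d3) by (eapply Rle_trans; [apply Rmin_r | apply Rmin_r]).
assert (Hball : forall (e : posreal) x, d <= e -> Rabs (x - p) < d -> ball p e x).
{ intros e x A B. unfold ball; simpl. unfold AbsRing_ball, abs, minus, plus, opp; simpl.
  fold (x - p). lra. }
assert (Hmvt : forall a b, a < b -> Rabs (a - p) < d -> Rabs (b - p) < d ->
  exists xi, a < xi < b /\ f b - f a = f1 xi * (b - a)).
{ intros a b Hab A B.
  assert (C : forall x, a <= x <= b -> is_derive f x (f1 x)).
  { intros x Hx. apply H1, Hball; [exact L1 | ].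
    apply Rabs_def2 in A. apply Rabs_def2 in B. apply Rabs_def1; lra. }
  destruct (MVT_cor2 f f1 a b Hab) as (xi & E & F).
  - intros x Hx. apply is_derive_Reals, C, Hx.
  - exists xi. split; [exact F | exact E]. }
assert (Hp : Rabs (p - p) < d) by (rewrite Rminus_diag, Rabs_R0; exact Hd).
destruct (Rle_dec 0 (f1 p)) as [Hs | Hs].
- assert (A : Rabs (p + d / 2 - p) < d) by (apply Rabs_def1; lra).
  destruct (Hmvt p (p + d / 2)) as (xi & Hxi & E); try assumption; [lra | ].
  assert (B := H3 _ (Hball d3 _ L3 A)).
  assert (C := Hsl (xi - p) ltac:(lra) ltac:(apply Rabs_def1; lra)).
  replace (p + (xi - p)) with xi in C by ring.
  apply Rmult_lt_compat_r with (r := xi - p) in C; [ | lra].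
  unfold Rdiv in C. rewrite Rmult_assoc, Rinv_l in C by lra. nra.
- assert (A : Rabs (p - d / 2 - p) < d) by (apply Rabs_def1; lra).
  destruct (Hmvt (p - d / 2) p) as (xi & Hxi & E); try assumption; [lra | ].
  assert (B := H3 _ (Hball d3 _ L3 A)).
  assert (C := Hsl (xi - p) ltac:(lra) ltac:(apply Rabs_def1; lra)).
  replace (p + (xi - p)) with xi in C by ring.
  apply Rmult_lt_compat_r with (r := p - xi) in C; [ | lra].
  replace ((f1 xi - f1 p) / (xi - p) * (p - xi)) with (f1 p - f1 xi) in C by (field; lra).
  nra.
Qed.

(** The left-hand side is the second derivative at p of ln (f^2 + g^2) + psi, which is maximal where
    the product is. *)
Lemma weighted_sq_max (f g f1 g1 psi psi1 : R -> R) (p f2 g2 psi2 : R) :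
  locally p (fun x => is_derive f x (f1 x)) ->
  locally p (fun x => is_derive g x (g1 x)) ->
  locally p (fun x => is_derive psi x (psi1 x)) ->
  is_derive f1 p f2 -> is_derive g1 p g2 -> is_derive psi1 p psi2 ->
  0 < f p ^ 2 + g p ^ 2 ->
  locally p (fun x => (f x ^ 2 + g x ^ 2) * exp (psi x)
                      <= (f p ^ 2 + g p ^ 2) * exp (psi p)) ->
  (2 * (f1 p ^ 2 + g1 p ^ 2 + f p * f2 + g p * g2) * (f p ^ 2 + g p ^ 2)
    - (2 * (f p * f1 p + g p * g1 p)) ^ 2) / (f p ^ 2 + g p ^ 2) ^ 2 + psi2 <= 0.
Proof.
intros Df Dg Dpsi Df1 Dg1 Dpsi1 Hpos Hmax.
assert (Ep : forall (k k1 : R -> R), locally p (fun x => is_derive k x (k1 x)) ->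
  is_derive k p (k1 p)).
{ intros k k1 Hk. now apply locally_singleton in Hk. }
assert (HD : forall (k : R -> R) x l, is_derive k x l -> Derive (fun z => k z) x = l).
{ intros k x l Hk. now apply is_derive_unique. }
assert (Dfp := Ep _ _ Df). assert (Dgp := Ep _ _ Dg).
assert (Hloc : locally p (fun x => 0 < f x ^ 2 + g x ^ 2)).
{ assert (C : continuous (fun x => f x ^ 2 + g x ^ 2) p).
  { apply (ex_derive_continuous (V := R_NormedModule)).
    auto_derive. split; [now exists (f1 p) | split; [now exists (g1 p) | trivial]]. }
  apply C. apply (open_gt 0), Hpos. }
apply (second_derivative_test (fun x => ln (f x ^ 2 + g x ^ 2) + psi x)
  (fun x => 2 * (f x * f1 x + g x * g1 x) / (f x ^ 2 + g x ^ 2) + psi1 x) p).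
- generalize (filter_and _ _ (filter_and _ _ Df Dg) (filter_and _ _ Dpsi Hloc)).
  apply filter_imp. intros x [[A B] [C D]].
  auto_derive.
  + repeat split; try (now eexists; eassumption). simpl in D |- *. lra.
  + rewrite (HD _ _ _ A), (HD _ _ _ B), (HD _ _ _ C). simpl in D |- *. field. lra.
- auto_derive.
  + repeat split; try (now eexists; eassumption). simpl in Hpos |- *. lra.
  + rewrite (HD _ _ _ Dfp), (HD _ _ _ Dgp), (HD _ _ _ Df1), (HD _ _ _ Dg1),
      (HD _ _ _ Dpsi1). simpl in Hpos |- *. field. lra.
- generalize (filter_and _ _ Hloc Hmax). apply filter_imp. intros x [A B].
  apply Rnot_lt_le. intro C. apply exp_increasing in C. revert C.
  apply Rle_not_lt. rewrite !exp_plus, !exp_ln by assumption. exact B.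
Qed.

Lemma locally_interval (a b p : R) : a < p < b -> locally p (fun x => a < x < b).
Proof.
intros Hp. apply filter_and; [apply open_gt | apply open_lt]; lra.
Qed.

(** The existence of partial derivatives does not give joint continuity, but here they are also
    bounded near the point, and two mean value steps, one in each variable, give a Lipschitz
    estimate. This supplies [rectangle_max] with the continuity of the primitives. *)
Lemma continuity_2d_pt_partials (U P Q : R -> R -> R) (x y : R) (d : posreal) :
  (forall s t, Rabs (s - x) < d -> Rabs (t - y) < d ->
     is_derive (fun z => U z t) s (P s t) /\ is_derive (fun z => U s z) t (Q s t)) ->
  continuity_2d_pt P x y -> continuity_2d_pt Q x y -> continuity_2d_pt U x y.
Proof.
intros HU HP HQ eps.
destruct (HP (mkposreal 1 Rlt_0_1)) as [d1 K1].
destruct (HQ (mkposreal 1 Rlt_0_1)) as [d2 K2]. simpl in K1, K2.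
set (M := 1 + Rabs (P x y) + Rabs (Q x y)).
assert (HM : 0 < M).
{ unfold M. assert (A := Rabs_pos (P x y)). assert (B := Rabs_pos (Q x y)). lra. }
set (e := Rmin (Rmin d (eps / (2 * M))) (Rmin d1 d2)).
assert (He : 0 < e).
{ unfold e. repeat apply Rmin_pos; try apply cond_pos.
  apply Rdiv_lt_0_compat; [apply cond_pos | lra]. }
assert (L1 : e <= d) by (eapply Rle_trans; [apply Rmin_l | apply Rmin_l]).
assert (L2 : e <= eps / (2 * M)) by (eapply Rle_trans; [apply Rmin_l | apply Rmin_r]).
assert (L3 : e <= d1) by (eapply Rle_trans; [apply Rmin_r | apply Rmin_l]).
assert (L4 : e <= d2) by (eapply Rle_trans; [apply Rmin_r | apply Rmin_r]).
assert (Hbd : forall s t, Rabs (s - x) < e -> Rabs (t - y) < e ->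
  Rabs (P s t) <= M /\ Rabs (Q s t) <= M).
{ intros s t A B.
  assert (C := K1 s t ltac:(lra) ltac:(lra)). assert (D := K2 s t ltac:(lra) ltac:(lra)).
  assert (E := Rabs_triang (P s t - P x y) (P x y)).
  assert (F := Rabs_triang (Q s t - Q x y) (Q x y)).
  replace (P s t - P x y + P x y) with (P s t) in E by ring.
  replace (Q s t - Q x y + Q x y) with (Q s t) in F by ring.
  assert (A' := Rabs_pos (P x y)). assert (B' := Rabs_pos (Q x y)).
  unfold M. lra. }
exists (mkposreal e He). simpl. intros s t Hs Ht.
assert (A1 : Rabs (U s t - U x t) <= M * Rabs (s - x)).
{ destruct (MVT_gen (fun z => U z t) x s (fun z => P z t)) as (c & Hc & E).
  - intros z Hz. apply HU; [ | lra].
    apply Rle_lt_trans with (2 := Rlt_le_trans _ _ _ Hs L1).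
    apply Rabs_le_between_min_max. rewrite Rmin_comm, Rmax_comm. lra.
  - intros z Hz. apply continuity_pt_filterlim.
    apply (ex_derive_continuous (V := R_NormedModule) (fun z => U z t)). exists (P z t). apply HU; [ | lra].
    apply Rle_lt_trans with (2 := Rlt_le_trans _ _ _ Hs L1).
    apply Rabs_le_between_min_max. rewrite Rmin_comm, Rmax_comm. lra.
  - simpl in E. rewrite E, Rabs_mult. apply Rmult_le_compat_r; [apply Rabs_pos | ].
    apply Hbd; [ | exact Ht]. apply Rle_lt_trans with (2 := Hs).
    apply Rabs_le_between_min_max. rewrite Rmin_comm, Rmax_comm. lra. }
assert (A2 : Rabs (U x t - U x y) <= M * Rabs (t - y)).
{ assert (Hx : Rabs (x - x) < e) by (rewrite Rminus_diag, Rabs_R0; exact He).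
  destruct (MVT_gen (fun z => U x z) y t (fun z => Q x z)) as (c & Hc & E).
  - intros z Hz. apply HU; [lra | ].
    apply Rle_lt_trans with (2 := Rlt_le_trans _ _ _ Ht L1).
    apply Rabs_le_between_min_max. rewrite Rmin_comm, Rmax_comm. lra.
  - intros z Hz. apply continuity_pt_filterlim.
    apply (ex_derive_continuous (V := R_NormedModule) (fun z => U x z)). exists (Q x z). apply HU; [lra | ].
    apply Rle_lt_trans with (2 := Rlt_le_trans _ _ _ Ht L1).
    apply Rabs_le_between_min_max. rewrite Rmin_comm, Rmax_comm. lra.
  - simpl in E. rewrite E, Rabs_mult. apply Rmult_le_compat_r; [apply Rabs_pos | ].
    apply Hbd; [exact Hx | ]. apply Rle_lt_trans with (2 := Ht).
    apply Rabs_le_between_min_max. rewrite Rmin_comm, Rmax_comm. lra. }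
replace (U s t - U x y) with ((U s t - U x t) + (U x t - U x y)) by ring.
eapply Rle_lt_trans; [apply Rabs_triang | ].
assert (B1 : M * Rabs (s - x) < M * (eps / (2 * M))) by (apply Rmult_lt_compat_l; lra).
assert (B2 : M * Rabs (t - y) < M * (eps / (2 * M))) by (apply Rmult_lt_compat_l; lra).
replace (M * (eps / (2 * M))) with (eps / 2) in B1, B2 by (field; lra). lra.
Qed.

Lemma is_derive_RInt_interval (f : R -> R) (a b c x : R) :
  (forall t, a < t < b -> continuous f t) -> a < c < b -> a < x < b ->
  is_derive (fun z => RInt f c z) x (f x).
Proof.
intros Hf Hc Hx. apply (is_derive_RInt f _ c); [ | now apply Hf].
generalize (locally_interval a b x Hx). apply filter_imp. intros z Hz.
apply (RInt_correct (V := R_CompleteNormedModule)), (ex_RInt_continuous (V := R_CompleteNormedModule)).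
intros t [T1 T2]. apply Hf.
split; [apply Rlt_le_trans with (2 := T1); apply Rmin_glb_lt; lra
       | apply Rle_lt_trans with (1 := T2); apply Rmax_lub_lt; lra].
Qed.

(* Integrating from the line x = 2, on which the form vanishes, makes the
   horizontal integral alone a primitive. *)
Lemma strip_primitive (P Q : R -> R -> R) (al y1 y2 : R) :
  al < 1 ->
  (forall x y, al < x -> y1 < y < y2 -> exists a b c,
     differentiable_pt_lim P x y a b /\ differentiable_pt_lim Q x y b c) ->
  (forall x y, 1 < x -> y1 < y < y2 -> P x y = 0 /\ Q x y = 0) ->
  exists U : R -> R -> R,
    (forall x y, al < x -> y1 < y < y2 ->
       is_derive (fun z => U z y) x (P x y) /\ is_derive (fun z => U x z) y (Q x y)) /\
    (forall x y, 1 < x -> y1 < y < y2 -> U x y = 0).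
Proof.
intros Hal Hd Hz.
assert (CP : forall x y, al < x -> y1 < y < y2 -> continuous (fun t => P t y) x).
{ intros x y A B. destruct (Hd x y A B) as (a & b & c & D1 & _).
  apply continuity_2d_pt_x, differentiable_continuity_pt. now exists a, b. }
assert (CQ : forall x y, al < x -> y1 < y < y2 -> continuous (fun t => Q x t) y).
{ intros x y A B. destruct (Hd x y A B) as (a & b & c & _ & D1).
  apply continuity_2d_pt_y, differentiable_continuity_pt. now exists b, c. }
pose (U := fun x y => RInt (fun t => P t y) 2 x).
assert (U0 : forall x y, 1 < x -> y1 < y < y2 -> U x y = 0).
{ intros x y Hx Hy. unfold U.
  rewrite (RInt_ext _ (fun _ => 0)).
  - rewrite RInt_const. apply Rmult_0_r.
  - intros t [T _]. apply Hz; [ | exact Hy].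
    apply Rlt_trans with (2 := T). apply Rmin_glb_lt; lra. }
assert (EQ : forall x a b, al < x -> y1 < a < y2 -> y1 < b < y2 ->
  ex_RInt (fun t => Q x t) a b).
{ intros x a b A B C. apply (ex_RInt_continuous (V := R_CompleteNormedModule)).
  intros z [Z1 Z2]. apply CQ; [exact A | ].
  split; [apply Rlt_le_trans with (2 := Z1); apply Rmin_glb_lt; lra
         | apply Rle_lt_trans with (1 := Z2); apply Rmax_lub_lt; lra]. }
(* Independence of the path: for x <= 1 this is Goursat on the rectangle between the abscissas x and
   2, whose right side contributes 0; for x > 1 both sides vanish. The vertical derivative of [U]
   follows from it. *)
assert (Hlt : forall x y t, al < x -> y1 < y -> y < t -> t < y2 ->
  U x t - U x y = RInt (fun s => Q x s) y t).
{ intros x y t Hx Hy1 Hyt Ht.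
  destruct (Rlt_dec 1 x) as [H1 | H1].
  - rewrite !U0 by lra. rewrite (RInt_ext _ (fun _ => 0)).
    + rewrite RInt_const. unfold scal; simpl; unfold mult; simpl. ring.
    + rewrite Rmin_left, Rmax_right by lra. intros s Hs. apply Hz; lra.
  - assert (G := goursat P Q x 2 y t ltac:(lra) ltac:(lra)).
    assert (EP : forall s, y <= s <= t -> ex_RInt (fun z => P z s) x 2).
    { intros s Hs. apply (ex_RInt_continuous (V := R_CompleteNormedModule)).
      rewrite Rmin_left, Rmax_right by lra. intros z Hzz. apply CP; lra. }
    unfold boundary_int in G.
    rewrite (RInt_minus (V := R_CompleteNormedModule)) in G by (apply EP; lra).
    rewrite (RInt_ext _ (fun s => opp (Q x s)) y t) in G.
    2: { rewrite Rmin_left, Rmax_right by lra. intros s Hs.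
         rewrite (proj2 (Hz 2 s ltac:(lra) ltac:(lra))). unfold opp; simpl. ring. }
    rewrite (RInt_opp (V := R_CompleteNormedModule)) in G by (apply EQ; lra).
    unfold U.
    rewrite <- !(opp_RInt_swap (V := R_CompleteNormedModule) _ x 2) by (apply EP; lra).
    unfold minus, plus, opp in *; simpl in *.
    enough (E : RInt (fun z => P z y) x 2 - RInt (fun z => P z t) x 2 - RInt (fun s => Q x s) y t = 0) by lra.
    rewrite <- G; [reflexivity | ].
    intros x' y' A B. apply Hd; lra. }
exists U. split; [ | exact U0].
intros x y Hx Hy. split.
- apply (is_derive_RInt_interval (fun t => P t y) al (Rmax x 2 + 1)).
  + intros t Ht. apply CP; [apply Ht | exact Hy].
  + assert (A := Rmax_r x 2). lra.
  + assert (A := Rmax_l x 2). lra.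
- apply (is_derive_ext_loc (fun t => U x y + RInt (fun s => Q x s) y t)).
  + generalize (locally_interval y1 y2 y Hy). apply filter_imp. intros t Ht.
    change (@eq R (U x y + RInt (fun s => Q x s) y t) (U x t)).
    destruct (Rtotal_order y t) as [L | [<- | L]].
    * rewrite <- Hlt by lra. ring.
    * rewrite (RInt_point (V := R_CompleteNormedModule)). apply Rplus_0_r.
    * rewrite <- (opp_RInt_swap (V := R_CompleteNormedModule)) by (apply EQ; lra).
      rewrite <- Hlt by lra. unfold opp; simpl. ring.
  + replace (Q x y) with (0 + Q x y) by ring.
    apply (is_derive_plus (V := R_NormedModule)).
    * apply (is_derive_const (V := R_NormedModule)).
    * apply (is_derive_RInt_interval (fun t => Q x t) y1 y2); try exact Hy.
      intros t Ht. now apply CQ.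
Qed.

Lemma differentiable_pt_lim_partials (P : R -> R -> R) (x y a b : R) :
  differentiable_pt_lim P x y a b ->
  is_derive (fun z => P z y) x a /\ is_derive (fun z => P x z) y b.
Proof.
intros H. split; apply is_derive_Reals.
- replace a with (a * 1 + b * 0) by ring.
  apply (derivable_pt_lim_comp_2d P (fun z => z) (fun _ => y) x a b 1 0 H).
  + apply derivable_pt_lim_id.
  + apply derivable_pt_lim_const.
- replace b with (a * 0 + b * 1) by ring.
  apply (derivable_pt_lim_comp_2d P (fun _ => x) (fun z => z) y a b 0 1 H).
  + apply derivable_pt_lim_const.
  + apply derivable_pt_lim_id.
Qed.

(** The complex derivative of u + iv is a + ib. Only differentiability at the point itself is
    recorded, without continuity of the partial derivatives. *)
Definition cr_at (u v : R -> R -> R) (x y : R) : Prop :=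
  exists a b, differentiable_pt_lim u x y a (- b) /\ differentiable_pt_lim v x y b a.

(* The weight is strictly subharmonic where its cosine is positive, while
   ln (U^2 + V^2) is harmonic where U + iV does not vanish. *)
Lemma weighted_modulus_no_max (U V u v : R -> R -> R) (x0 y0 a lam x1 x2 y1 y2 p q : R) :
  0 < a -> 0 < lam -> x1 < p < x2 -> y1 < q < y2 -> 0 < cos (a * (q - y0)) ->
  (forall x y, x1 < x < x2 -> y1 < y < y2 ->
     cr_at u v x y /\
     (is_derive (fun z => U z y) x (u x y) /\ is_derive (fun z => U x z) y (- v x y)) /\
     (is_derive (fun z => V z y) x (v x y) /\ is_derive (fun z => V x z) y (u x y))) ->
  let G x y := (U x y ^ 2 + V x y ^ 2) *
    exp (lam * exp (2 * a * (x - x0)) * cos (a * (y - y0))) in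
  0 < G p q ->
  ~ (forall x y, x1 < x < x2 -> y1 < y < y2 -> G x y <= G p q).
Proof.
intros Ha Hlam Hp Hq Hcos Hd G HG Hmax.
destruct (Hd p q Hp Hq) as ((c & d & Du & Dv) & _).
destruct (differentiable_pt_lim_partials _ _ _ _ _ Du) as [Dux Duy].
destruct (differentiable_pt_lim_partials _ _ _ _ _ Dv) as [Dvx Dvy].
assert (HW : 0 < U p q ^ 2 + V p q ^ 2).
{ unfold G in HG. apply Rnot_le_lt. intro C. revert HG. apply Rle_not_lt.
  apply Rmult_le_0_r; [exact C | apply Rlt_le, exp_pos]. }
assert (Lx := locally_interval x1 x2 p Hp). assert (Ly := locally_interval y1 y2 q Hq).
assert (Ix := weighted_sq_max (fun x => U x q) (fun x => V x q) (fun x => u x q)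
  (fun x => v x q) (fun x => lam * exp (2 * a * (x - x0)) * cos (a * (q - y0)))
  (fun x => lam * (2 * a) * exp (2 * a * (x - x0)) * cos (a * (q - y0))) p c d
  (lam * (2 * a) ^ 2 * exp (2 * a * (p - x0)) * cos (a * (q - y0)))).
assert (Iy := weighted_sq_max (fun y => U p y) (fun y => V p y) (fun y => - v p y)
  (fun y => u p y) (fun y => lam * exp (2 * a * (p - x0)) * cos (a * (y - y0)))
  (fun y => - (lam * a) * exp (2 * a * (p - x0)) * sin (a * (y - y0))) q (- c) (- d)
  (- (lam * a ^ 2) * exp (2 * a * (p - x0)) * cos (a * (q - y0)))).
cbv beta in Ix, Iy.
assert (Jx := Ix ltac:(generalize Lx; apply filter_imp; intros x Hx; now apply Hd)
  ltac:(generalize Lx; apply filter_imp; intros x Hx; now apply Hd)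
  ltac:(apply filter_forall; intros x; auto_derive; [trivial | unfold Rminus; ring])
  Dux Dvx ltac:(auto_derive; [trivial | unfold Rminus; ring]) HW
  ltac:(generalize Lx; apply filter_imp; intros x Hx; now apply Hmax)).
assert (Jy := Iy ltac:(generalize Ly; apply filter_imp; intros x Hx; now apply Hd)
  ltac:(generalize Ly; apply filter_imp; intros x Hx; now apply Hd)
  ltac:(apply filter_forall; intros x; auto_derive; [trivial | unfold Rminus; ring])
  ltac:(apply (is_derive_opp (V := R_NormedModule) (fun y => v p y)), Dvy) Duy
  ltac:(auto_derive; [trivial | unfold Rminus; ring]) HW
  ltac:(generalize Ly; apply filter_imp; intros x Hx; now apply Hmax)).
clear Ix Iy.
set (E := exp (2 * a * (p - x0))) in *. set (C := cos (a * (q - y0))) in *.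
assert (HE : 0 < E) by apply exp_pos.
set (W := U p q ^ 2 + V p q ^ 2) in *.
(* Harmonicity of ln (U^2 + V^2): the second derivatives are c, d in x and -c, -d in y, and the two
   quotients cancel. What is left of the sum of the two inequalities is the Laplacian of the weight,
   (4 - 1) lam a^2 E C, which would have to be at most 0. *)
assert (S : (2 * (u p q ^ 2 + v p q ^ 2 + U p q * c + V p q * d) * W
   - (2 * (U p q * u p q + V p q * v p q)) ^ 2) / W ^ 2 +
  (2 * ((- v p q) ^ 2 + u p q ^ 2 + U p q * - c + V p q * - d) * W
   - (2 * (U p q * - v p q + V p q * u p q)) ^ 2) / W ^ 2 = 0).
{ unfold W in *. field. lra. }
assert (K : 0 < lam * a ^ 2 * E * C).
{ repeat apply Rmult_lt_0_compat; try assumption; lra. }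
nra.
Qed.

Lemma ex_derive_continuity_pt (f : R -> R) (x : R) : ex_derive f x -> continuity_pt f x.
Proof.
intros H. apply continuity_pt_filterlim.
now apply (ex_derive_continuous (V := R_NormedModule) f).
Qed.

Lemma differentiable_pt_lim_opp (P : R -> R -> R) (x y a b : R) :
  differentiable_pt_lim P x y a b ->
  differentiable_pt_lim (fun s t => - P s t) x y (- a) (- b).
Proof.
intros H eps. destruct (H eps) as [d Hd]. exists d. intros s t Hs Ht.
replace (- P s t - - P x y - (- a * (s - x) + - b * (t - y))) with
  (- (P s t - P x y - (a * (s - x) + b * (t - y)))) by ring.
rewrite Rabs_Ropp. now apply Hd.
Qed.

(** Suppose H = U + iV is not 0 at (x0, y0), where x0 <= 1. On a rectangle reaching from x1 < x0 to
    the abscissa 2, the weighted |H|^2 has a maximum; [Hedge] and the vanishing of H on the right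
    side exclude the boundary, [weighted_modulus_no_max] the interior. *)
Lemma strip_unique_continuation (u v : R -> R -> R) (al y0 eta : R) :
  al < 1 -> 0 < eta ->
  (forall x y, al < x -> y0 - eta < y < y0 + eta -> cr_at u v x y) ->
  (forall x y, 1 < x -> y0 - eta < y < y0 + eta -> u x y = 0 /\ v x y = 0) ->
  forall x, al < x -> u x y0 = 0 /\ v x y0 = 0.
Proof.
intros Hal Heta Hcr Hz.
(* The forms to integrate are the real and imaginary parts of (u + iv)(dx + i dy). *)
destruct (strip_primitive u (fun x y => - v x y) al (y0 - eta) (y0 + eta)) as (U & DU & U0).
{ exact Hal. }
{ intros x y Hx Hy. destruct (Hcr x y Hx Hy) as (a & b & A & B).
  exists a, (- b), (- a). split; [exact A | now apply differentiable_pt_lim_opp]. }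
{ intros x y Hx Hy. destruct (Hz x y Hx Hy) as [-> ->]. split; ring. }
destruct (strip_primitive v u al (y0 - eta) (y0 + eta)) as (V & DV & V0).
{ exact Hal. }
{ intros x y Hx Hy. destruct (Hcr x y Hx Hy) as (a & b & A & B).
  exists b, a, (- b). now split. }
{ intros x y Hx Hy. destruct (Hz x y Hx Hy) as [-> ->]. split; ring. }
(* This is enough because u and v are the x-derivatives of U and V along the line y = y0. *)
enough (HW : forall x, al < x -> U x y0 ^ 2 + V x y0 ^ 2 = 0).
{ intros x Hx.
  assert (HUV : forall z, al < z -> U z y0 = 0 /\ V z y0 = 0).
  { intros z Hz'. specialize (HW z Hz'). split; nra. }
  assert (L : forall (F : R -> R -> R) f, (forall z, al < z -> F z y0 = 0) ->
    is_derive (fun z => F z y0) x f -> f = 0).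
  { intros F f HF Df. apply is_derive_unique in Df. rewrite <- Df.
    apply is_derive_unique. apply (is_derive_ext_loc (fun _ => 0)).
    - generalize (open_gt al x Hx). apply filter_imp. intros t Ht. now rewrite HF.
    - apply (is_derive_const (V := R_NormedModule)). }
  split.
  - apply (L U); [intros; now apply HUV | ]. apply (DU x y0); lra.
  - apply (L V); [intros; now apply HUV | ]. apply (DV x y0); lra. }
assert (Ccr : forall x y, al < x -> y0 - eta < y < y0 + eta ->
  continuity_2d_pt u x y /\ continuity_2d_pt v x y).
{ intros x y Hx Hy. destruct (Hcr x y Hx Hy) as (a & b & A & B).
  split; apply differentiable_continuity_pt; [now exists a, (- b) | now exists b, a]. }
assert (CUV : forall x y, al < x -> y0 - eta < y < y0 + eta ->
  continuity_2d_pt U x y /\ continuity_2d_pt V x y).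
{ intros x y Hx Hy.
  assert (Hd : 0 < Rmin (x - al) (Rmin (y - (y0 - eta)) (y0 + eta - y))).
  { repeat apply Rmin_pos; lra. }
  assert (Hin : forall s t, Rabs (s - x) < mkposreal _ Hd -> Rabs (t - y) < mkposreal _ Hd ->
    al < s /\ y0 - eta < t < y0 + eta).
  { simpl. intros s t Hs Ht. apply Rabs_def2 in Hs. apply Rabs_def2 in Ht.
    assert (B1 := Rmin_l (x - al) (Rmin (y - (y0 - eta)) (y0 + eta - y))).
    assert (B2 := Rmin_r (x - al) (Rmin (y - (y0 - eta)) (y0 + eta - y))).
    assert (B3 := Rmin_l (y - (y0 - eta)) (y0 + eta - y)).
    assert (B4 := Rmin_r (y - (y0 - eta)) (y0 + eta - y)). lra. }
  destruct (Ccr x y Hx Hy) as [Cu Cv].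
  split.
  - apply (continuity_2d_pt_partials U u (fun x y => - v x y) x y (mkposreal _ Hd)).
    + intros s t Hs Ht. destruct (Hin s t Hs Ht). now apply DU.
    + exact Cu.
    + now apply continuity_2d_pt_opp.
  - apply (continuity_2d_pt_partials V v u x y (mkposreal _ Hd)); try assumption.
    intros s t Hs Ht. destruct (Hin s t Hs Ht). now apply DV. }
pose (W := fun x y => U x y ^ 2 + V x y ^ 2).
assert (CW : forall x y, al < x -> y0 - eta < y < y0 + eta -> continuity_2d_pt W x y).
{ intros x y Hx Hy. destruct (CUV x y Hx Hy) as [CU CV].
  apply (continuity_2d_pt_ext (fun s t => U s t * U s t + V s t * V s t)).
  { intros; unfold W; ring. }
  apply continuity_2d_pt_plus; now apply continuity_2d_pt_mult. }
intros x0 Hx0. fold (W x0 y0).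
destruct (Rlt_dec 1 x0) as [H1 | H1].
{ unfold W. rewrite U0, V0 by lra. ring. }
apply NNPP. intro N.
assert (W0 : 0 < W x0 y0).
{ assert (A : 0 <= W x0 y0) by (unfold W; nra). lra. }
set (x1 := (x0 + al) / 2). set (y1 := y0 - eta / 2). set (y2 := y0 + eta / 2).
assert (Hx1 : al < x1 < x0) by (unfold x1; lra).
destruct (rectangle_max x1 2 y1 y2 W) as (p & q & Hp & Hq & HM);
  [lra | unfold y1, y2; lra
  | intros x y Hx Hy; unfold y1, y2 in Hy; apply CW; lra | ].
set (M := W p q) in *. clearbody M.
assert (HM0 : 0 < M).
{ apply Rlt_le_trans with (1 := W0). apply HM; unfold y1, y2; lra. }
clear p q Hp Hq.
assert (HPI := PI_RGT_0).
(* This frequency puts the zeros of the cosine on the horizontal sides y0 - eta / 2 and y0 + eta / 2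
   and keeps it positive between them. *)
set (a := PI / eta). assert (Ha : 0 < a) by (now apply Rdiv_lt_0_compat).
set (k := exp (2 * a * (x1 - x0))).
assert (Hk : 0 < k < 1).
{ split; [apply exp_pos | ]. unfold k. rewrite <- exp_0. apply exp_increasing. nra. }
(* Solves W (1 + lam (1 - k)) = W + M with W = [W x0 y0]; since e^t > 1 + t, the factor exp (lam (1
   - k)) then lifts W above M. *)
set (lam := M / (W x0 y0 * (1 - k))).
assert (Hlam : 0 < lam).
{ apply Rdiv_lt_0_compat; [exact HM0 | apply Rmult_lt_0_compat; lra]. }
set (G := fun x y => W x y * exp (lam * exp (2 * a * (x - x0)) * cos (a * (y - y0)))).
assert (CG : forall x y, al < x -> y0 - eta < y < y0 + eta -> continuity_2d_pt G x y).
{ intros x y Hx Hy. unfold G. apply continuity_2d_pt_mult; [now apply CW | ].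
  apply (continuity_1d_2d_pt_comp exp); [apply derivable_continuous_pt, derivable_pt_exp | ].
  apply continuity_2d_pt_mult.
  - apply (continuity_1d_2d_pt_comp (fun z => lam * exp (2 * a * (z - x0))) (fun s _ => s)).
    + apply ex_derive_continuity_pt. now auto_derive.
    + apply continuity_2d_pt_id1.
  - apply (continuity_1d_2d_pt_comp (fun z => cos (a * (z - y0))) (fun _ t => t)).
    + apply ex_derive_continuity_pt. now auto_derive.
    + apply continuity_2d_pt_id2. }
destruct (rectangle_max x1 2 y1 y2 G) as (p & q & Hp & Hq & HG);
  [lra | unfold y1, y2; lra
  | intros x y Hx Hy; unfold y1, y2 in Hy; apply CG; lra | ].
assert (Hy12 : y1 = y0 - eta / 2 /\ y2 = y0 + eta / 2) by (split; reflexivity).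
clearbody y1 y2. destruct Hy12 as [Ey1 Ey2].
assert (G0 : W x0 y0 * exp lam <= G p q).
{ apply Rle_trans with (G x0 y0); [ | apply HG; lra].
  unfold G. rewrite !Rminus_diag, !Rmult_0_r, exp_0, cos_0, !Rmult_1_r. lra. }
assert (Gpos : 0 < G p q).
{ apply Rlt_le_trans with (2 := G0). apply Rmult_lt_0_compat; [exact W0 | apply exp_pos]. }
(* On the left and horizontal sides the exponent is at most lam k (c is k or 0 there), against lam
   at (x0, y0). Division by exp (lam k) leaves [W x0 y0] exp (lam (1 - k)) <= M, which the choice of
   lam excludes. *)
assert (Hedge : forall c, c <= k -> G p q <= M * exp (lam * c) -> False).
{ intros c Hc HGc.
  assert (A : W x0 y0 * exp lam <= M * exp (lam * k)).
  { apply Rle_trans with (1 := G0). apply Rle_trans with (1 := HGc).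
    apply Rmult_le_compat_l; [lra | ].
    destruct (Req_dec c k) as [-> | Nc]; [lra | ].
    apply Rlt_le, exp_increasing, Rmult_lt_compat_l; lra. }
  assert (B : exp lam = exp (lam * k) * exp (lam * (1 - k))).
  { rewrite <- exp_plus. f_equal. ring. }
  assert (C := exp_ineq1 (lam * (1 - k)) ltac:(apply Rgt_not_eq, Rmult_lt_0_compat; lra)).
  assert (D := exp_pos (lam * k)).
  assert (E : W x0 y0 * (1 + lam * (1 - k)) = W x0 y0 + M).
  { unfold lam. field. lra. }
  rewrite B in A.
  assert (F : W x0 y0 * exp (lam * (1 - k)) <= M).
  { apply Rmult_le_reg_l with (1 := D). nra. }
  assert (W x0 y0 * (1 + lam * (1 - k)) < W x0 y0 * exp (lam * (1 - k)))
    by (apply Rmult_lt_compat_l; lra).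
  lra. }
assert (Hae : a * (eta / 2) = PI / 2) by (unfold a; field; lra).
assert (HWM : W p q <= M) by (apply HM; lra).
assert (Hedge' : forall c, c <= k ->
  lam * exp (2 * a * (p - x0)) * cos (a * (q - y0)) <= lam * c -> False).
{ intros c Hc A. apply (Hedge c Hc). unfold G.
  apply Rmult_le_compat; [ | apply Rlt_le, exp_pos | exact HWM | ].
  - unfold W; nra.
  - destruct A as [A | ->]; [ | lra]. apply Rlt_le, exp_increasing, A. }
assert (Hcos0 : forall z, z = - (PI / 2) \/ z = PI / 2 -> cos z = 0).
{ intros z [-> | ->]; [rewrite cos_neg | ]; apply cos_PI2. }
destruct (Req_dec q y1) as [-> | Nq1].
{ apply (Hedge' 0); [lra | ]. rewrite (Hcos0 (a * (y1 - y0))).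
  - lra.
  - left. rewrite <- Hae, Ey1. ring. }
destruct (Req_dec q y2) as [-> | Nq2].
{ apply (Hedge' 0); [lra | ]. rewrite (Hcos0 (a * (y2 - y0))).
  - lra.
  - right. rewrite <- Hae, Ey2. ring. }
destruct (Req_dec p x1) as [-> | Np1].
{ apply (Hedge' k); [lra | ]. fold k.
  destruct (COS_bound (a * (q - y0))) as [_ Hcb].
  assert (0 < lam * k) by (apply Rmult_lt_0_compat; lra). nra. }
destruct (Req_dec p 2) as [-> | Np2].
{ revert Gpos. unfold G, W. rewrite U0, V0 by lra. lra. }
refine (weighted_modulus_no_max U V u v x0 y0 a lam x1 2 y1 y2 p q Ha Hlam _ _ _ _ Gpos _).
- lra.
- lra.
- apply cos_gt_0.
  + rewrite <- Hae. nra.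
  + rewrite <- Hae. nra.
- intros x y Hx Hy.
  split; [apply Hcr; lra | ]. split; [apply DU; lra | apply DV; lra].
- intros x y Hx Hy. apply HG; lra.
Qed.

(** * Complex derivatives and the Cauchy-Riemann equations *)

Definition cdiff (h : C -> C) (z l : C) : Prop :=
  forall eps : R, 0 < eps -> exists d, 0 < d /\ forall w, Cmod (w - z) < d ->
    Cmod (h w - h z - l * (w - z))%C <= eps * Cmod (w - z)%C.

Lemma C_differentiable_cdiff (h : C -> C) (z : C) :
  C_differentiable_at h z -> exists l, cdiff h z l.
Proof.
intros [l [_ Hl]]. exists l. intros eps Heps.
destruct (Hl z (fun P HP => HP) (mkposreal eps Heps)) as [d Hd].
exists d. split; [apply cond_pos | ]. intros w Hw.
assert (A := Hd w Hw).
unfold norm, minus, plus, opp, scal in A; simpl in A.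
unfold mult in A; simpl in A.
replace (h w - h z - l * (w - z))%C with (h w + - h z + - ((w + - z) * l))%C by ring.
exact A.
Qed.

Lemma Im_le_Cmod (z : C) : Rabs (Im z) <= Cmod z.
Proof. eapply Rle_trans; [apply Rmax_r | apply Rmax_Cmod]. Qed.

Lemma Cmod_le_Rmax (x y : R) : Cmod (x, y) <= 2 * Rmax (Rabs x) (Rabs y).
Proof.
replace (x, y) with (RtoC x + RtoC y * Ci)%C.
2: { unfold Cplus, Cmult, RtoC, Ci; simpl. f_equal; ring. }
eapply Rle_trans; [apply Cmod_triangle | ].
rewrite Cmod_mult, !Cmod_R, Cmod_Ci.
assert (A := Rmax_l (Rabs x) (Rabs y)). assert (B := Rmax_r (Rabs x) (Rabs y)). lra.
Qed.

Lemma cdiff_cr (h : C -> C) (x y : R) (l : C) :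
  cdiff h (x, y) l -> cr_at (fun s t => Re (h (s, t))) (fun s t => Im (h (s, t))) x y.
Proof.
intros H. exists (Re l), (Im l).
assert (K : forall eps : posreal, exists d : posreal, forall s t,
  Rabs (s - x) < d -> Rabs (t - y) < d ->
  Cmod (h (s, t) - h (x, y) - l * ((s - x)%R, (t - y)%R))%C
    <= eps * Rmax (Rabs (s - x)) (Rabs (t - y))).
{ intros eps. destruct (H (eps / 2)) as (d & Hd & Hd2); [apply (is_pos_div_2 eps) | ].
  assert (Hdd : 0 < d / 2) by lra.
  exists (mkposreal _ Hdd). simpl. intros s t Hs Ht.
  assert (E : ((s, t) - (x, y))%C = (s - x, t - y)) by reflexivity.
  assert (A := Cmod_le_Rmax (s - x) (t - y)).
  assert (B : Rmax (Rabs (s - x)) (Rabs (t - y)) < d / 2) by now apply Rmax_lub_lt.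
  specialize (Hd2 (s, t)). rewrite E in Hd2.
  eapply Rle_trans; [apply Hd2; lra | ].
  assert (C0 := cond_pos eps). nra. }
destruct l as [a b].
split; intros eps; destruct (K eps) as [d Hd]; exists d; intros s t Hs Ht;
  (eapply Rle_trans; [ | apply (Hd s t Hs Ht)]).
- eapply Rle_trans; [ | apply re_le_Cmod]. apply Req_le. f_equal.
  destruct (h (s, t)), (h (x, y)). simpl. ring.
- eapply Rle_trans; [ | apply Im_le_Cmod]. apply Req_le. f_equal.
  destruct (h (s, t)), (h (x, y)). simpl. ring.
Qed.

Lemma holomorphic_unique_continuation (h : C -> C) (al y0 eta : R) :
  al < 1 -> 0 < eta ->
  (forall z, al < Re z -> y0 - eta < Im z < y0 + eta -> exists l, cdiff h z l) ->
  (forall z, 1 < Re z -> y0 - eta < Im z < y0 + eta -> h z = 0) ->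
  forall x, al < x -> h (x, y0) = 0.
Proof.
intros Hal Heta Hd Hz x Hx.
destruct (strip_unique_continuation (fun s t => Re (h (s, t))) (fun s t => Im (h (s, t)))
  al y0 eta Hal Heta) with (x := x) as [A B]; try assumption.
- intros s t Hs Ht. destruct (Hd (s, t) Hs Ht) as [l Hl]. now apply cdiff_cr with l.
- intros s t Hs Ht. now rewrite (Hz (s, t) Hs Ht).
- destruct (h (x, y0)) as [a b]. simpl in A, B. now rewrite A, B.
Qed.

Lemma cdiff_continuous (h : C -> C) (z l : C) : cdiff h z l ->
  forall eps, 0 < eps -> exists d, 0 < d /\ forall w, Cmod (w - z) < d ->
    Cmod (h w - h z) < eps.
Proof.
intros H eps Heps. destruct (H 1 Rlt_0_1) as (d & Hd & Hd2).
assert (HK : 0 < 1 + Cmod l) by (assert (A := Cmod_ge_0 l); lra).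
exists (Rmin d (eps / (1 + Cmod l))). split.
{ apply Rmin_pos; [exact Hd | now apply Rdiv_lt_0_compat]. }
intros w Hw.
assert (A := Hd2 w ltac:(eapply Rlt_le_trans; [exact Hw | apply Rmin_l])).
assert (B : Cmod (w - z) < eps / (1 + Cmod l)) by (eapply Rlt_le_trans; [exact Hw | apply Rmin_r]).
replace (h w - h z)%C with ((h w - h z - l * (w - z)) + l * (w - z))%C by ring.
eapply Rle_lt_trans; [apply Cmod_triangle | ]. rewrite Cmod_mult.
apply (Rmult_lt_compat_l (1 + Cmod l)) in B; [ | exact HK].
replace ((1 + Cmod l) * (eps / (1 + Cmod l))) with eps in B by (field; lra). lra.
Qed.

Lemma cdiff_const (c z : C) : cdiff (fun _ => c) z 0.
Proof.
intros eps Heps. exists 1. split; [lra | ]. intros w _.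
replace (c - c - 0 * (w - z))%C with (RtoC 0) by ring. rewrite Cmod_0.
apply Rmult_le_pos; [lra | apply Cmod_ge_0].
Qed.

Lemma cdiff_minus (f g : C -> C) (z l m : C) :
  cdiff f z l -> cdiff g z m -> cdiff (fun w => f w - g w)%C z (l - m)%C.
Proof.
intros Hf Hg eps Heps.
destruct (Hf (eps / 2) ltac:(lra)) as (d1 & D1 & K1).
destruct (Hg (eps / 2) ltac:(lra)) as (d2 & D2 & K2).
exists (Rmin d1 d2). split; [now apply Rmin_pos | ]. intros w Hw.
assert (A := K1 w ltac:(eapply Rlt_le_trans; [exact Hw | apply Rmin_l])).
assert (B := K2 w ltac:(eapply Rlt_le_trans; [exact Hw | apply Rmin_r])).
replace (f w - g w - (f z - g z) - (l - m) * (w - z))%C with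
  ((f w - f z - l * (w - z)) + - (g w - g z - m * (w - z)))%C by ring.
eapply Rle_trans; [apply Cmod_triangle | ]. rewrite Cmod_opp. lra.
Qed.

Lemma cdiff_mult (f g : C -> C) (z l m : C) :
  cdiff f z l -> cdiff g z m -> cdiff (fun w => f w * g w)%C z (l * g z + f z * m)%C.
Proof.
intros Hf Hg eps Heps.
set (A := Cmod (f z)). set (B := Cmod (g z)). set (L := Cmod l).
assert (HA : 0 <= A) by apply Cmod_ge_0. assert (HB : 0 <= B) by apply Cmod_ge_0.
assert (HL : 0 <= L) by apply Cmod_ge_0.
(* The four error terms of the product carry the coefficients 1, A, B and L. *)
set (e := eps / (1 + A + B + L + 1)).
assert (He : 0 < e) by (apply Rdiv_lt_0_compat; lra).
assert (Ee : e * (1 + A + B + L + 1) = eps) by (unfold e; field; lra).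
destruct (Hf (Rmin e 1) ltac:(apply Rmin_pos; lra)) as (d1 & D1 & K1).
destruct (Hg (Rmin e 1) ltac:(apply Rmin_pos; lra)) as (d2 & D2 & K2).
destruct (cdiff_continuous g z m Hg e He) as (d3 & D3 & K3).
exists (Rmin d1 (Rmin d2 d3)). split; [repeat apply Rmin_pos; assumption | ].
intros w Hw.
assert (W1 : Cmod (w - z) < d1) by (eapply Rlt_le_trans; [exact Hw | apply Rmin_l]).
assert (W2 : Cmod (w - z) < d2).
{ eapply Rlt_le_trans; [exact Hw | ]. eapply Rle_trans; [apply Rmin_r | apply Rmin_l]. }
assert (W3 : Cmod (w - z) < d3).
{ eapply Rlt_le_trans; [exact Hw | ]. eapply Rle_trans; [apply Rmin_r | apply Rmin_r]. }
specialize (K1 w W1). specialize (K2 w W2). specialize (K3 w W3).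
assert (M1 := Rmin_l e 1). assert (M2 := Rmin_r e 1).
set (D := Cmod (w - z)) in *. assert (HD : 0 <= D) by apply Cmod_ge_0.
replace (f w * g w - f z * g z - (l * g z + f z * m) * (w - z))%C with
  ((f w - f z - l * (w - z)) * (g w - g z) + (f w - f z - l * (w - z)) * g z +
   f z * (g w - g z - m * (w - z)) + l * (w - z) * (g w - g z))%C by ring.
set (rf := (f w - f z - l * (w - z))%C) in *.
set (rg := (g w - g z - m * (w - z))%C) in *.
set (dg := (g w - g z)%C) in *.
assert (T1 : Cmod (rf * dg) <= D * e).
{ rewrite Cmod_mult. apply Rmult_le_compat; try apply Cmod_ge_0; [ | lra].
  apply Rle_trans with (1 := K1). nra. }
assert (T2 : Cmod (rf * g z) <= e * D * B).
{ rewrite Cmod_mult. apply Rmult_le_compat_r; [exact HB | ].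
  apply Rle_trans with (1 := K1). nra. }
assert (T3 : Cmod (f z * rg) <= A * (e * D)).
{ rewrite Cmod_mult. apply Rmult_le_compat_l; [exact HA | ].
  apply Rle_trans with (1 := K2). nra. }
assert (T4 : Cmod (l * (w - z) * dg) <= L * D * e).
{ rewrite !Cmod_mult. apply Rmult_le_compat_l; [ | lra]. now apply Rmult_le_pos. }
eapply Rle_trans; [apply Cmod_triangle | ].
eapply Rle_trans; [apply Rplus_le_compat_r, Cmod_triangle | ].
eapply Rle_trans; [apply Rplus_le_compat_r, Rplus_le_compat_r, Cmod_triangle | ].
rewrite <- Ee. nra.
Qed.

(** * Dirichlet series *)

Definition cderiv (f : R -> C) (x : R) (l : C) : Prop :=
  is_derive (fun t => Re (f t)) x (Re l) /\ is_derive (fun t => Im (f t)) x (Im l).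

Lemma cderiv_plus (f g : R -> C) (x : R) (l m : C) :
  cderiv f x l -> cderiv g x m -> cderiv (fun t => f t + g t)%C x (l + m)%C.
Proof.
intros [A B] [D E]. split.
- apply (is_derive_plus (V := R_NormedModule) _ _ _ _ _ A D).
- apply (is_derive_plus (V := R_NormedModule) _ _ _ _ _ B E).
Qed.

Lemma cderiv_opp (f : R -> C) (x : R) (l : C) :
  cderiv f x l -> cderiv (fun t => - f t)%C x (- l)%C.
Proof.
intros [A B]. split.
- apply (is_derive_opp (V := R_NormedModule) _ _ _ A).
- apply (is_derive_opp (V := R_NormedModule) _ _ _ B).
Qed.

Lemma cderiv_const (c : C) (x : R) : cderiv (fun _ => c) x 0%C.
Proof.
split.
- exact (is_derive_const (V := R_NormedModule) (Re c) x).
- exact (is_derive_const (V := R_NormedModule) (Im c) x).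
Qed.

Lemma cderiv_RtoC (x : R) : cderiv RtoC x 1%C.
Proof.
split.
- exact (is_derive_id (K := R_AbsRing) x).
- exact (is_derive_const (V := R_NormedModule) 0 x).
Qed.

Lemma cderiv_mult (f g : R -> C) (x : R) (l m : C) :
  cderiv f x l -> cderiv g x m -> cderiv (fun t => f t * g t)%C x (l * g x + f x * m)%C.
Proof.
intros [A B] [D E]. split.
- replace (Re (l * g x + f x * m)%C) with
    ((Re l * Re (g x) + Re (f x) * Re m) - (Im l * Im (g x) + Im (f x) * Im m)).
  2: { destruct l, m, (f x), (g x). simpl. ring. }
  apply (is_derive_minus (V := R_NormedModule)); now apply Derive.is_derive_mult.
- replace (Im (l * g x + f x * m)%C) with
    ((Re l * Im (g x) + Re (f x) * Im m) + (Im l * Re (g x) + Im (f x) * Re m)).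
  2: { destruct l, m, (f x), (g x). simpl. ring. }
  apply (is_derive_plus (V := R_NormedModule)); now apply Derive.is_derive_mult.
Qed.

Lemma cderiv_Cexp (z : C) (x : R) :
  cderiv (fun t => Cexp (z * RtoC t)) x (z * Cexp (z * RtoC x))%C.
Proof.
destruct z as [a b]. split.
- apply (is_derive_ext (fun t => exp (a * t) * cos (b * t))).
  { intros t. unfold Cexp, Cmult, Re, Im, RtoC; simpl.
    replace (a * t - b * 0) with (a * t) by ring.
    now replace (a * 0 + b * t) with (b * t) by ring. }
  auto_derive; [trivial | ].
  unfold Cexp, Cmult, Re, Im, RtoC; simpl.
  replace (a * x - b * 0) with (a * x) by ring.
  replace (a * 0 + b * x) with (b * x) by ring. ring.
- apply (is_derive_ext (fun t => exp (a * t) * sin (b * t))).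
  { intros t. unfold Cexp, Cmult, Re, Im, RtoC; simpl.
    replace (a * t - b * 0) with (a * t) by ring.
    now replace (a * 0 + b * t) with (b * t) by ring. }
  auto_derive; [trivial | ].
  unfold Cexp, Cmult, Re, Im, RtoC; simpl.
  replace (a * x - b * 0) with (a * x) by ring.
  replace (a * 0 + b * x) with (b * x) by ring. ring.
Qed.

Lemma Cmod_Cexp (z : C) : Cmod (Cexp z) = exp (Re z).
Proof.
unfold Cexp, Cmod; simpl. assert (A := exp_pos (Re z)).
replace (exp (Re z) * cos (Im z) * (exp (Re z) * cos (Im z) * 1) +
         exp (Re z) * sin (Im z) * (exp (Re z) * sin (Im z) * 1))
  with (exp (Re z) * exp (Re z) * (Rsqr (sin (Im z)) + Rsqr (cos (Im z))))
  by (unfold Rsqr; ring).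
rewrite sin2_cos2, Rmult_1_r. apply sqrt_square. lra.
Qed.

Lemma Cexp_plus (z w : C) : Cexp (z + w) = (Cexp z * Cexp w)%C.
Proof.
destruct z as [a b], w as [c d]. unfold Cexp, Cplus, Cmult, Re, Im; simpl.
rewrite exp_plus, cos_plus, sin_plus. f_equal; ring.
Qed.

Lemma Cexp_0 : Cexp 0 = 1%C.
Proof. unfold Cexp, Re, Im, RtoC; simpl. rewrite exp_0, cos_0, sin_0. f_equal; ring. Qed.

(* Project the increment of [r] on its own direction and apply the real mean
   value inequality. *)
Lemma dominated_increment (r r1 : R -> C) (G G1 : R -> R) (a b : R) :
  a <= b ->
  (forall x, a <= x <= b -> cderiv r x (r1 x)) ->
  (forall x, a <= x <= b -> is_derive G x (G1 x)) ->
  (forall x, a <= x <= b -> Cmod (r1 x) <= G1 x) ->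
  Cmod (r b - r a) <= G b - G a.
Proof.
intros Hab Hr HG Hd.
destruct Hab as [Hab | <-].
2: { replace (r a - r a)%C with (RtoC 0) by ring. rewrite Cmod_0. lra. }
set (D := (r b - r a)%C).
destruct (Req_dec (Cmod D) 0) as [E | N].
{ rewrite E.
  destruct (MVT_cor2 G G1 a b Hab) as (c & Ec & Hc).
  { intros x Hx. apply is_derive_Reals, HG, Hx. }
  rewrite Ec. apply Rmult_le_pos; [ | lra].
  apply Rle_trans with (2 := Hd c ltac:(lra)). apply Cmod_ge_0. }
assert (HD : 0 < Cmod D) by (assert (A := Cmod_ge_0 D); lra).
pose (phi := fun x => Re D * Re (r x) + Im D * Im (r x)).
pose (phi1 := fun x => Re D * Re (r1 x) + Im D * Im (r1 x)).
destruct (MVT_cor2 (fun x => Cmod D * G x - phi x) (fun x => Cmod D * G1 x - phi1 x) a b Hab)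
  as (c & Ec & Hc).
{ intros x Hx. apply is_derive_Reals. destruct (Hr x Hx) as [A B].
  apply (is_derive_minus (V := R_NormedModule)).
  - apply (is_derive_scal G); now apply HG.
  - apply (is_derive_plus (V := R_NormedModule)).
    + now apply (is_derive_scal (fun t => Re (r t))).
    + now apply (is_derive_scal (fun t => Im (r t))). }
assert (CS : phi1 c <= Cmod D * Cmod (r1 c)).
{ replace (phi1 c) with (Re (Cconj D * r1 c)).
  2: { unfold phi1. destruct D, (r1 c). simpl. ring. }
  rewrite <- (Cmod_conj D), <- Cmod_mult.
  eapply Rle_trans; [apply Rle_abs | apply re_le_Cmod]. }
assert (Hphi : phi b - phi a = Cmod D * Cmod D).
{ replace (Cmod D * Cmod D) with (Cmod D ^ 2) by ring. rewrite Cmod2_alt.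
  unfold phi, D. destruct (r a), (r b). simpl. ring. }
assert (Hge : 0 <= (Cmod D * G1 c - phi1 c) * (b - a)).
{ apply Rmult_le_pos; [ | lra]. specialize (Hd c ltac:(lra)). nra. }
apply Rmult_le_reg_l with (1 := HD). lra.
Qed.

Lemma cderiv_eq (f : R -> C) (x : R) (l m : C) : cderiv f x l -> l = m -> cderiv f x m.
Proof. now intros H <-. Qed.

Lemma Cexp_minus_1_bound (z : C) (t : R) : 0 <= t ->
  Cmod (Cexp (z * RtoC t) - 1) <= exp (Cmod z * t) - 1.
Proof.
intros Ht.
replace (Cexp (z * RtoC t) - 1)%C with (Cexp (z * RtoC t) - Cexp (z * RtoC 0))%C.
2: { now rewrite Cmult_0_r, Cexp_0. }
replace (exp (Cmod z * t) - 1) with (exp (Cmod z * t) - exp (Cmod z * 0)).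
2: { now rewrite Rmult_0_r, exp_0. }
apply (dominated_increment (fun x => Cexp (z * RtoC x)) (fun x => z * Cexp (z * RtoC x))%C
  (fun x => exp (Cmod z * x)) (fun x => Cmod z * exp (Cmod z * x))).
- exact Ht.
- intros x _. apply cderiv_Cexp.
- intros x _. auto_derive; [trivial | ring].
- intros x Hx. rewrite Cmod_mult, Cmod_Cexp.
  apply Rmult_le_compat_l; [apply Cmod_ge_0 | ].
  assert (A : Re (z * RtoC x) <= Cmod z * x).
  { apply Rle_trans with (Cmod (z * RtoC x)).
    - eapply Rle_trans; [apply Rle_abs | apply re_le_Cmod].
    - rewrite Cmod_mult, Cmod_R, Rabs_right by lra. lra. }
  destruct A as [A | ->]; [ | lra]. now apply Rlt_le, exp_increasing.
Qed.

Lemma Cexp_taylor1_bound (z : C) :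
  Cmod (Cexp z - 1 - z) <= Cmod z ^ 2 * exp (Cmod z).
Proof.
set (c := Cmod z). assert (Hc : 0 <= c) by apply Cmod_ge_0.
assert (A : Cmod (Cexp z - 1 - z) <= exp c - 1 - c).
{ replace (Cexp z - 1 - z)%C with
    ((Cexp (z * RtoC 1) + - z * RtoC 1) - (Cexp (z * RtoC 0) + - z * RtoC 0))%C.
  2: { rewrite Cmult_1_r, Cmult_0_r, Cexp_0. ring. }
  replace (exp c - 1 - c) with ((exp (c * 1) - c * 1) - (exp (c * 0) - c * 0)).
  2: { rewrite Rmult_1_r, Rmult_0_r, exp_0. ring. }
  apply (dominated_increment (fun x => Cexp (z * RtoC x) + - z * RtoC x)%C
    (fun x => z * (Cexp (z * RtoC x) - 1))%C
    (fun x => exp (c * x) - c * x) (fun x => c * (exp (c * x) - 1))).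
  - lra.
  - intros x _. eapply cderiv_eq.
    + apply cderiv_plus; [apply cderiv_Cexp | apply cderiv_mult; [apply cderiv_const | apply cderiv_RtoC]].
    + cbv beta. ring.
  - intros x _. auto_derive; [trivial | ring].
  - intros x Hx. rewrite Cmod_mult. apply Rmult_le_compat_l; [exact Hc | ].
    apply Cexp_minus_1_bound; lra. }
apply Rle_trans with (1 := A).
(* e^c - 1 = e^c (1 - e^(-c)) <= c e^c, used twice *)
assert (B : forall y, 1 - y <= exp (- y)).
{ intros y. assert (B := exp_ineq1_le (- y)). lra. }
assert (E : exp c * exp (- c) = 1) by (rewrite <- exp_plus, Rplus_opp_r; apply exp_0).
assert (P := exp_pos c).
assert (B1 : exp c - 1 <= c * exp c).
{ assert (B1 := Rmult_le_compat_l (exp c) _ _ (Rlt_le _ _ P) (B c)). lra. }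
assert (B2 := Rmult_le_compat_l c _ _ Hc B1).
replace (c ^ 2 * exp c) with (c * (c * exp c)) by ring. lra.
Qed.

(** * Partial sums and limits of complex sequences *)

(** The index n is excluded, unlike in [sum_n]; telescoping and Abel summation then start from an
    empty sum. *)
Fixpoint psum (z : nat -> C) (n : nat) : C :=
  match n with O => 0%C | S m => (psum z m + z m)%C end.

Definition climit (s : nat -> C) (l : C) : Prop :=
  forall eps : R, 0 < eps -> exists N, forall n, (N <= n)%nat -> Cmod (s n - l) < eps.

Lemma climit_ext (s t : nat -> C) (l : C) :
  (forall n, s n = t n) -> climit s l -> climit t l.
Proof.
intros E H eps Heps. destruct (H eps Heps) as [N HN]. exists N. intros n Hn.
rewrite <- E. now apply HN.
Qed.

Lemma climit_plus (s t : nat -> C) (l m : C) :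
  climit s l -> climit t m -> climit (fun n => s n + t n)%C (l + m)%C.
Proof.
intros Hs Ht eps Heps.
destruct (Hs (eps / 2) ltac:(lra)) as [N HN].
destruct (Ht (eps / 2) ltac:(lra)) as [M HM].
exists (max N M). intros n Hn.
specialize (HN n ltac:(lia)). specialize (HM n ltac:(lia)).
replace (s n + t n - (l + m))%C with ((s n - l) + (t n - m))%C by ring.
eapply Rle_lt_trans; [apply Cmod_triangle | lra].
Qed.

Lemma climit_scal (c : C) (s : nat -> C) (l : C) :
  climit s l -> climit (fun n => c * s n)%C (c * l)%C.
Proof.
intros Hs eps Heps. assert (HK := Cmod_ge_0 c).
destruct (Hs (eps / (1 + Cmod c))) as [N HN]; [apply Rdiv_lt_0_compat; lra | ].
exists N. intros n Hn. specialize (HN n Hn).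
replace (c * s n - c * l)%C with (c * (s n - l))%C by ring. rewrite Cmod_mult.
apply (Rmult_lt_compat_l (1 + Cmod c)) in HN; [ | lra].
replace ((1 + Cmod c) * (eps / (1 + Cmod c))) with eps in HN by (field; lra).
assert (A := Cmod_ge_0 (s n - l)). lra.
Qed.

Lemma climit_const (c : C) : climit (fun _ => c) c.
Proof.
intros eps Heps. exists O. intros n _.
replace (c - c)%C with (RtoC 0) by ring. now rewrite Cmod_0.
Qed.

Lemma climit_subseq (f : nat -> nat) (s : nat -> C) (l : C) :
  (forall n, (n <= f n)%nat) -> climit s l -> climit (fun n => s (f n)) l.
Proof.
intros Hf Hs eps Heps. destruct (Hs eps Heps) as [N HN]. exists N. intros n Hn.
apply HN. specialize (Hf n). lia.
Qed.

Lemma climit_bound (s : nat -> C) (l : C) (B : R) :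
  (forall n, Cmod (s n) <= B) -> climit s l -> Cmod l <= B.
Proof.
intros HB Hs. apply Rnot_lt_le. intro A.
destruct (Hs (Cmod l - B) ltac:(lra)) as [N HN].
specialize (HN N (Nat.le_refl N)). specialize (HB N).
assert (T := Cmod_triangle (s N) (l - s N)).
replace (s N + (l - s N))%C with l in T by ring.
replace (s N - l)%C with (- (l - s N))%C in HN by ring.
rewrite Cmod_opp in HN. lra.
Qed.

Lemma climit_unique (s : nat -> C) (l m : C) : climit s l -> climit s m -> l = m.
Proof.
intros Hl Hm.
assert (A : climit (fun n => s n + (-1) * s n)%C (l + (-1) * m)%C).
{ apply climit_plus; [exact Hl | now apply climit_scal]. }
assert (B : Cmod (l + (-1) * m) <= 0).
{ apply climit_bound with (2 := A). intros n.
  replace (s n + (-1) * s n)%C with (RtoC 0) by ring. rewrite Cmod_0. lra. }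
assert (E : (l + (-1) * m)%C = 0%C).
{ apply Cmod_eq_0. assert (D := Cmod_ge_0 (l + (-1) * m)). lra. }
replace l with (l + (-1) * m + m)%C by ring. rewrite E. ring.
Qed.

Lemma psum_ext (z w : nat -> C) (n : nat) : (forall j, z j = w j) -> psum z n = psum w n.
Proof. intros H. induction n as [ | n IH]; [reflexivity | ]. simpl. now rewrite IH, H. Qed.

Lemma psum_plus (z w : nat -> C) (n : nat) :
  psum (fun j => z j + w j)%C n = (psum z n + psum w n)%C.
Proof. induction n as [ | n IH]; simpl; [ring | rewrite IH; ring]. Qed.

Lemma psum_scal (c : C) (z : nat -> C) (n : nat) :
  psum (fun j => c * z j)%C n = (c * psum z n)%C.
Proof. induction n as [ | n IH]; simpl; [ring | rewrite IH; ring]. Qed.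

(** Majorants enter as differences [T n - T (S n)], so that [T] bounds tails at once and no real
    majorant series has to be summed. *)
Lemma psum_telescope_bound (z : nat -> C) (T : nat -> R) (m k : nat) :
  (forall n, Cmod (z n) <= T n - T (S n)) ->
  Cmod (psum z (m + k) - psum z m) <= T m - T (m + k)%nat.
Proof.
intros Hz. induction k as [ | k IH].
- rewrite Nat.add_0_r. replace (psum z m - psum z m)%C with (RtoC 0) by ring.
  rewrite Cmod_0. lra.
- rewrite Nat.add_succ_r. simpl.
  replace (psum z (m + k) + z (m + k)%nat - psum z m)%C with
    ((psum z (m + k) - psum z m) + z (m + k)%nat)%C by ring.
  eapply Rle_trans; [apply Cmod_triangle | ]. specialize (Hz (m + k)%nat). lra.
Qed.

Lemma psum_bound (z : nat -> C) (T : nat -> R) (n : nat) :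
  (forall n, Cmod (z n) <= T n - T (S n)) -> Cmod (psum z n) <= T O - T n.
Proof.
intros Hz. replace (psum z n) with (psum z (0 + n) - psum z 0)%C.
- now apply (psum_telescope_bound z T 0 n).
- simpl. ring.
Qed.

Lemma psum_converges (z : nat -> C) (T : nat -> R) :
  (forall n, 0 <= T n) -> (forall n, Cmod (z n) <= T n - T (S n)) ->
  exists l, climit (psum z) l.
Proof.
intros HT Hz.
assert (CT : Cauchy_crit T).
{ apply CV_Cauchy, decreasing_cv.
  - intros n. assert (A := Cmod_ge_0 (z n)). specialize (Hz n). lra.
  - exists 0. intros x [n ->]. unfold opp_seq. specialize (HT n). lra. }
assert (Cz : forall eps, eps > 0 -> exists N, forall n m, (n >= N)%nat -> (m >= N)%nat ->
  Cmod (psum z n - psum z m) < eps).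
{ intros eps Heps. destruct (CT eps Heps) as [N HN]. exists N.
  assert (W : forall m k, (m >= N)%nat -> Cmod (psum z (m + k) - psum z m) < eps).
  { intros m k Hm. eapply Rle_lt_trans; [now apply (psum_telescope_bound z T) | ].
    specialize (HN m (m + k)%nat Hm ltac:(lia)). unfold Rdist in HN.
    apply Rabs_def2 in HN. lra. }
  intros n m Hn Hm. destruct (Nat.le_ge_cases m n) as [L | L].
  - replace n with (m + (n - m))%nat by lia. now apply W.
  - replace (psum z n - psum z m)%C with (- (psum z m - psum z n))%C by ring.
    rewrite Cmod_opp. replace m with (n + (m - n))%nat by lia. now apply W. }
destruct (Rcomplete.R_complete (fun n => Re (psum z n))) as [a Ha].
{ intros eps Heps. destruct (Cz eps Heps) as [N HN]. exists N. intros n m Hn Hm.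
  eapply Rle_lt_trans; [ | apply (HN n m Hn Hm)].
  apply (re_le_Cmod (psum z n - psum z m)%C). }
destruct (Rcomplete.R_complete (fun n => Im (psum z n))) as [b Hb].
{ intros eps Heps. destruct (Cz eps Heps) as [N HN]. exists N. intros n m Hn Hm.
  eapply Rle_lt_trans; [ | apply (HN n m Hn Hm)].
  apply (Im_le_Cmod (psum z n - psum z m)%C). }
exists (a, b). intros eps Heps.
destruct (Ha (eps / 2) ltac:(lra)) as [N HN].
destruct (Hb (eps / 2) ltac:(lra)) as [M HM].
exists (max N M). intros n Hn.
specialize (HN n ltac:(lia)). specialize (HM n ltac:(lia)). unfold Rdist in HN, HM.
eapply Rle_lt_trans; [apply Cmod_le_Rmax | ].
assert (B : Rmax (Rabs (Re (psum z n) - a)) (Rabs (Im (psum z n) - b)) < eps / 2)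
  by now apply Rmax_lub_lt.
unfold Re, Im, Rminus in *. simpl. lra.
Qed.

Lemma is_series_climit (a : nat -> C) (l : C) :
  @is_series C_AbsRing C_NormedModule a l -> climit (psum a) l.
Proof.
intros H.
assert (E : forall n, sum_n (G := C_AbelianMonoid) a n = psum a (S n)).
{ induction n as [ | n IH].
  - rewrite sum_O. simpl. ring.
  - rewrite sum_Sn, IH. reflexivity. }
intros eps Heps.
assert (L : locally (T := C_NormedModule) l (fun w : C => Cmod (w - l) < eps)).
{ apply (locally_le_locally_norm (V := C_NormedModule) l).
  exists (mkposreal eps Heps). intros w Hw. exact Hw. }
destruct (H _ L) as [N HN]. exists (S N). intros [ | n] Hn; [lia | ].
assert (A := HN n ltac:(lia)). cbv beta in A.
change (Cmod (sum_n (G := C_AbelianMonoid) a n - l) < eps) in A. now rewrite E in A.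
Qed.

(** * The kernel m^(-s) in logarithmic form, and holomorphy of the series *)

(** At x = ln m this is m^(-s) and unfolds to the same term as [pow_neg]. A real variable in place
    of m lets increments be bounded by integrating derivatives. *)
Definition pexp (s : C) (x : R) : C := Cexp (- s * RtoC x).

Lemma pexp_cderiv (s : C) (x : R) : cderiv (pexp s) x (- s * pexp s x).
Proof. apply cderiv_Cexp. Qed.

Lemma Cmod_pexp (s : C) (x : R) : Cmod (pexp s x) = exp (- (Re s * x)).
Proof.
unfold pexp. rewrite Cmod_Cexp. f_equal. destruct s. simpl. ring.
Qed.

Lemma exp_quadratic_bound (y : R) : 0 <= y -> y ^ 2 <= 4 * exp y.
Proof.
intros Hy. assert (A := exp_ineq1_le (y / 2)).
replace (exp y) with (exp (y / 2) * exp (y / 2)) by (rewrite <- exp_plus; f_equal; field).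
nra.
Qed.

(* With al = Re s / 4, half of the decay e^(-4 al x) of the kernel is left after
   the factors e^(al x) spent on |h| <= al and on the powers of x. *)
Lemma pexp_increment_bounds (s : C) : 0 < Re s ->
  exists K al, 0 < K /\ 0 < al /\ forall a b, 0 <= a -> a <= b ->
  let B := K * (exp (- (al * a)) - exp (- (al * b))) in
  Cmod (pexp s b - pexp s a) <= B /\
  Cmod (RtoC b * pexp s b - RtoC a * pexp s a) <= B /\
  forall h, Cmod h <= 1 -> Cmod h <= al ->
    let rem x := (pexp (s + h) x - pexp s x + h * (RtoC x * pexp s x))%C in
    Cmod (rem b - rem a) <= Cmod h ^ 2 * B.
Proof.
intros Hs. set (al := Re s / 4). assert (Hal : 0 < al) by (unfold al; lra).
set (S := Cmod s). assert (HS : 0 <= S) by apply Cmod_ge_0.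
assert (Hal2 : 0 < 4 / al ^ 2) by (apply Rdiv_lt_0_compat; [lra | now apply pow_lt]).
assert (Hial : 0 < / al) by now apply Rinv_0_lt_compat.
assert (HSal : 0 <= S * / al) by (apply Rmult_le_pos; lra).
assert (HS2 : 0 <= (S + 1) * (4 / al ^ 2)) by (apply Rmult_le_pos; lra).
(* One constant for three derivatives: S serves the kernel, 1 + S / al its product with x, and (S +
   1) 4 / al^2 + 1 / al the remainder [rem]. *)
set (Kd := 1 + S + S * / al + (S + 1) * (4 / al ^ 2) + / al).
assert (HKd : 0 < Kd) by (unfold Kd; lra).
assert (Hlin : forall x, 0 <= x -> x <= / al * exp (al * x)).
{ intros x Hx. assert (A := exp_ineq1_le (al * x)).
  apply Rmult_le_reg_l with (1 := Hal).
  replace (al * (/ al * exp (al * x))) with (exp (al * x)) by (field; lra). lra. }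
assert (Hsq : forall x, 0 <= x -> x ^ 2 <= 4 / al ^ 2 * exp (al * x)).
{ intros x Hx. assert (A := exp_quadratic_bound (al * x) ltac:(apply Rmult_le_pos; lra)).
  apply Rmult_le_reg_l with (al ^ 2); [now apply pow_lt | ].
  replace (al ^ 2 * (4 / al ^ 2 * exp (al * x))) with (4 * exp (al * x)) by (field; lra).
  rewrite Rpow_mult_distr in A. exact A. }
assert (Hmono : forall x c d, 0 <= x -> c <= d -> exp (c * x) <= exp (d * x)).
{ intros x c d Hx Hcd.
  destruct (Rle_lt_or_eq_dec (c * x) (d * x)) as [A | ->]; [nra | | lra].
  now apply Rlt_le, exp_increasing. }
assert (Hpexp : forall x, Cmod (pexp s x) = exp (- (4 * al) * x)).
{ intros x. rewrite Cmod_pexp. f_equal. unfold al. field. }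
pose (G := fun k x => - (k * Kd / al) * exp (- (al * x))).
pose (G1 := fun k x => k * (Kd * exp (- al * x))).
assert (HG : forall k x, is_derive (G k) x (G1 k x)).
{ intros k x. unfold G, G1. auto_derive; [trivial | ].
  replace (- (al * x)) with (- al * x) by ring. field. lra. }
assert (HGe : forall k a b, k * (Kd / al * (exp (- (al * a)) - exp (- (al * b))))
  = G k b - G k a).
{ intros. unfold G. field. lra. }
exists (Kd / al), al.
split; [now apply Rdiv_lt_0_compat | split; [exact Hal | ]].
intros a b Ha Hab B.
assert (EB : B = G 1 b - G 1 a) by (rewrite <- HGe; unfold B; ring).
split; [ | split].
- rewrite EB. apply (dominated_increment (pexp s) (fun x => - s * pexp s x)%C (G 1) (G1 1)); try exact Hab.
  + intros x _. apply pexp_cderiv.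
  + intros x _. apply HG.
  + intros x Hx. unfold G1. rewrite Cmod_mult, Cmod_opp, Hpexp, Rmult_1_l.
    apply Rmult_le_compat; [exact HS | apply Rlt_le, exp_pos | fold S; unfold Kd; lra | ].
    apply Hmono; lra.
- rewrite EB. apply (dominated_increment (fun x => RtoC x * pexp s x)%C
    (fun x => (1 - s * RtoC x) * pexp s x)%C (G 1) (G1 1)); try exact Hab.
  + intros x _. eapply cderiv_eq.
    * apply cderiv_mult; [apply cderiv_RtoC | apply pexp_cderiv].
    * cbv beta. ring.
  + intros x _. apply HG.
  + intros x Hx. unfold G1. rewrite Cmod_mult, Hpexp, Rmult_1_l.
    assert (A : Cmod (1 - s * RtoC x) <= 1 + S * x).
    { unfold Cminus. eapply Rle_trans; [apply Cmod_triangle | ].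
      rewrite Cmod_1, Cmod_opp, Cmod_mult, Cmod_R, Rabs_right by lra. fold S. lra. }
    assert (A2 : 1 + S * x <= Kd * exp (al * x)).
    { assert (C1 := Hlin x ltac:(lra)).
      assert (C2 : 1 <= exp (al * x)).
      { rewrite <- exp_0 at 1. replace 0 with (0 * x) by ring. apply Hmono; lra. }
      apply Rle_trans with (1 * exp (al * x) + S * (/ al * exp (al * x))).
      - apply Rplus_le_compat; [lra | apply Rmult_le_compat_l; lra].
      - replace (1 * exp (al * x) + S * (/ al * exp (al * x))) with
          ((1 + S * / al) * exp (al * x)) by ring.
        apply Rmult_le_compat_r; [apply Rlt_le, exp_pos | unfold Kd; lra]. }
    apply Rle_trans with (Kd * exp (al * x) * exp (- (4 * al) * x)).
    * apply Rmult_le_compat_r; [apply Rlt_le, exp_pos | lra].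
    * rewrite Rmult_assoc, <- exp_plus. apply Rmult_le_compat_l; [lra | ].
      replace (al * x + - (4 * al) * x) with (- (3 * al) * x) by ring.
      apply Hmono; lra.
- intros h Hh1 Hhal rem.
  unfold B. rewrite HGe.
  (* The derivative of [rem] is arranged so that its first-order part in h has cancelled: a Taylor
     remainder of the exponential and a multiple of h^2 are left. *)
  apply (dominated_increment rem
    (fun x => pexp s x * (- (s + h) * (Cexp (- h * RtoC x) - 1 - - h * RtoC x)
                          + h * h * RtoC x))%C
    (G (Cmod h ^ 2)) (G1 (Cmod h ^ 2))); try exact Hab.
  + intros x _. eapply cderiv_eq.
    * unfold rem, Cminus. apply cderiv_plus; [apply cderiv_plus; [apply pexp_cderiv | ] | ].
      -- apply cderiv_opp, pexp_cderiv.
      -- apply cderiv_mult; [apply cderiv_const | ].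
         apply cderiv_mult; [apply cderiv_RtoC | apply pexp_cderiv].
    * cbv beta. replace (pexp (s + h) x) with (pexp s x * Cexp (- h * RtoC x))%C.
      -- ring.
      -- unfold pexp. rewrite <- Cexp_plus. f_equal. ring.
  + intros x _. apply HG.
  + intros x Hx. unfold G1. rewrite Cmod_mult, Hpexp.
    set (H := Cmod h) in *. assert (HH : 0 <= H) by apply Cmod_ge_0.
    assert (R1 : Cmod (Cexp (- h * RtoC x) - 1 - - h * RtoC x)
      <= H ^ 2 * (4 / al ^ 2 * exp (2 * al * x))).
    { eapply Rle_trans; [apply Cexp_taylor1_bound | ].
      rewrite Cmod_mult, Cmod_opp, Cmod_R, Rabs_right by lra. fold H.
      rewrite Rpow_mult_distr, Rmult_assoc.
      apply Rmult_le_compat_l; [nra | ].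
      replace (2 * al * x) with (al * x + al * x) by ring. rewrite exp_plus, <- Rmult_assoc.
      apply Rmult_le_compat; [nra | apply Rlt_le, exp_pos | apply Hsq; lra | apply Hmono; lra]. }
    assert (R2 : x <= / al * exp (2 * al * x)).
    { apply Rle_trans with (1 := Hlin x ltac:(lra)).
      apply Rmult_le_compat_l; [lra | apply Hmono; lra]. }
    assert (R3 : Cmod (s + h) <= S + 1).
    { eapply Rle_trans; [apply Cmod_triangle | ]. fold S H. lra. }
    assert (R4 : Cmod (- (s + h) * (Cexp (- h * RtoC x) - 1 - - h * RtoC x) + h * h * RtoC x)
      <= H ^ 2 * (Kd * exp (2 * al * x))).
    { eapply Rle_trans; [apply Cmod_triangle | ].
      rewrite !Cmod_mult, Cmod_opp, Cmod_R, (Rabs_right x) by lra. fold H.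
      apply Rle_trans with ((S + 1) * (H ^ 2 * (4 / al ^ 2 * exp (2 * al * x)))
        + H * H * (/ al * exp (2 * al * x))).
      - apply Rplus_le_compat.
        + apply Rmult_le_compat; try apply Cmod_ge_0; assumption.
        + apply Rmult_le_compat_l; [nra | exact R2].
      - replace ((S + 1) * (H ^ 2 * (4 / al ^ 2 * exp (2 * al * x))) +
          H * H * (/ al * exp (2 * al * x))) with
          (H ^ 2 * (((S + 1) * (4 / al ^ 2) + / al) * exp (2 * al * x))) by ring.
        apply Rmult_le_compat_l; [nra | ].
        apply Rmult_le_compat_r; [apply Rlt_le, exp_pos | unfold Kd; lra]. }
    apply Rle_trans with (exp (- (4 * al) * x) * (H ^ 2 * (Kd * exp (2 * al * x)))).
    * apply Rmult_le_compat_l; [apply Rlt_le, exp_pos | exact R4].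
    * replace (exp (- (4 * al) * x) * (H ^ 2 * (Kd * exp (2 * al * x)))) with
        (H ^ 2 * (Kd * (exp (- (4 * al) * x) * exp (2 * al * x)))) by ring.
      rewrite <- exp_plus. apply Rmult_le_compat_l; [nra | ].
      apply Rmult_le_compat_l; [lra | ].
      replace (- (4 * al) * x + 2 * al * x) with (- (2 * al) * x) by ring.
      apply Hmono; lra.
Qed.

Definition log_succ (n : nat) : R := ln (INR (S n)).

Lemma INR_S_pos (n : nat) : 0 < INR (S n).
Proof. apply lt_0_INR. lia. Qed.

Lemma log_succ_ge_0 (n : nat) : 0 <= log_succ n.
Proof.
unfold log_succ. rewrite <- ln_1. apply ln_le; [lra | ].
rewrite S_INR. assert (A := pos_INR n). lra.
Qed.

Lemma log_succ_le (n : nat) : log_succ n <= log_succ (S n).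
Proof. apply ln_le; [apply INR_S_pos | apply le_INR; lia]. Qed.

Lemma log_succ_0 : log_succ 0 = 0.
Proof. apply ln_1. Qed.

Lemma exp_opp_log_succ (n : nat) : exp (- log_succ n) = / INR (S n).
Proof. unfold log_succ. rewrite exp_Ropp, exp_ln; [reflexivity | apply INR_S_pos]. Qed.

(* Index [j] stands for m = j + 1, here and in every series below. *)
Definition dirichlet_term (s : C) (j : nat) : C :=
  (pexp s (log_succ j) - pexp s (log_succ (S j)))%C.

(** The terms, their s-derivatives and their second-order remainders are dominated by the same
    telescoping increments, the remainders with a factor |h|^2. Hence the series and its termwise
    derivative converge, and the sum differs from its linear part by at most K |h|^2. *)
Lemma weighted_increment_series (c : nat -> R) :
  (forall j, Rabs (c j) <= 1) ->
  exists D : C -> C, forall s, 0 < Re s ->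
    climit (psum (fun j => RtoC (c j) * dirichlet_term s j)%C) (D s) /\
    exists l, cdiff D s l.
Proof.
intros Hc.
assert (Hbd : forall K al, 0 < K -> 0 < al ->
  let T n := K * exp (- (al * log_succ n)) in
  (forall n, 0 <= T n) /\ T O = K /\
  (forall z, (forall n, Cmod (z n) <= K * (exp (- (al * log_succ n)) - exp (- (al * log_succ (S n))))) ->
    forall n, Cmod (RtoC (c n) * z n) <= T n - T (S n))).
{ intros K al HK Hal T. split; [ | split].
  - intros n. apply Rlt_le, Rmult_lt_0_compat; [exact HK | apply exp_pos].
  - unfold T. rewrite log_succ_0, Rmult_0_r, Ropp_0, exp_0. ring.
  - intros z Hz n. rewrite Cmod_mult, Cmod_R. unfold T.
    rewrite <- Rmult_minus_distr_l.
    apply Rle_trans with (1 * Cmod (z n)).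
    + apply Rmult_le_compat_r; [apply Cmod_ge_0 | apply Hc].
    + rewrite Rmult_1_l. apply Hz. }
(* The condition on s sits under the existential so that choice gives a [D] on all of C; its values
   off the half-plane do not matter. *)
assert (Hconv : forall s, exists l, 0 < Re s ->
  climit (psum (fun j => RtoC (c j) * dirichlet_term s j)%C) l).
{ intros s. destruct (Rlt_dec 0 (Re s)) as [Hs | Hs]; [ | exists 0%C; tauto].
  destruct (pexp_increment_bounds s Hs) as (K & al & HK & Hal & H).
  destruct (Hbd K al HK Hal) as (T1 & _ & T3).
  destruct (psum_converges (fun j => RtoC (c j) * dirichlet_term s j)%C _ T1) as [l Hl].
  - apply T3. intros n. unfold dirichlet_term.
    replace (pexp s (log_succ n) - pexp s (log_succ (S n)))%C with
      (- (pexp s (log_succ (S n)) - pexp s (log_succ n)))%C by ring.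
    rewrite Cmod_opp. apply H; [apply log_succ_ge_0 | apply log_succ_le].
  - now exists l. }
assert (HD : exists D : C -> C, forall s, 0 < Re s ->
  climit (psum (fun j => RtoC (c j) * dirichlet_term s j)%C) (D s)).
{ exists (fun s => proj1_sig (constructive_indefinite_description _ (Hconv s))).
  intros s. now destruct constructive_indefinite_description. }
destruct HD as [D HD]. exists D. intros s Hs. split; [now apply HD | ].
destruct (pexp_increment_bounds s Hs) as (K & al & HK & Hal & H).
destruct (Hbd K al HK Hal) as (T1 & T2 & T3).
pose (td := fun j => (RtoC (log_succ (S j)) * pexp s (log_succ (S j))
  - RtoC (log_succ j) * pexp s (log_succ j))%C).
destruct (psum_converges (fun j => RtoC (c j) * td j)%C _ T1) as [l Hl].
{ apply T3. intros n. apply H; [apply log_succ_ge_0 | apply log_succ_le]. }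
exists l. intros eps Heps.
exists (Rmin (Rmin 1 al) (Rmin (Re s) (eps / K))). split.
{ repeat apply Rmin_pos; try lra. now apply Rdiv_lt_0_compat. }
intros w Hw. set (h := (w - s)%C) in *.
assert (h1 : Cmod h < 1).
{ eapply Rlt_le_trans; [exact Hw | ]. eapply Rle_trans; apply Rmin_l. }
assert (h2 : Cmod h < al).
{ eapply Rlt_le_trans; [exact Hw | ]. eapply Rle_trans; [apply Rmin_l | apply Rmin_r]. }
assert (h3 : Cmod h < Re s).
{ eapply Rlt_le_trans; [exact Hw | ]. eapply Rle_trans; [apply Rmin_r | apply Rmin_l]. }
assert (h4 : Cmod h < eps / K).
{ eapply Rlt_le_trans; [exact Hw | ]. eapply Rle_trans; [apply Rmin_r | apply Rmin_r]. }
assert (Ew : w = (s + h)%C) by (unfold h; ring).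
clearbody h.
assert (HRe : 0 < Re w).
{ assert (A := re_le_Cmod h). apply Rabs_le_between in A.
  rewrite Ew. unfold Re in *. simpl. lra. }
pose (rem := fun x => (pexp (s + h) x - pexp s x + h * (RtoC x * pexp s x))%C).
pose (z := fun n => (rem (log_succ (S n)) - rem (log_succ n))%C).
(* The minus sign arises because [dirichlet_term] subtracts the later value from the earlier one,
   while [z] does the opposite. *)
assert (Hlim : climit (psum (fun j => RtoC (c j) * z j)%C)
  (- (D w - D s - l * h))%C).
{ replace (- (D w - D s - l * h))%C with ((-1) * D w + (D s + h * l))%C by ring.
  apply climit_ext with (fun n =>
    (-1) * psum (fun j => RtoC (c j) * dirichlet_term w j) n +
    (psum (fun j => RtoC (c j) * dirichlet_term s j) n +
     h * psum (fun j => RtoC (c j) * td j) n))%C.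
  - intros n. rewrite <- !psum_scal, <- !psum_plus. apply psum_ext. intros j.
    unfold z, rem, td, dirichlet_term. rewrite Ew. ring.
  - apply climit_plus; [apply climit_scal, HD, HRe | ].
    apply climit_plus; [now apply HD | now apply climit_scal]. }
assert (HB : Cmod (- (D w - D s - l * h)) <= Cmod h ^ 2 * K).
{ apply climit_bound with (2 := Hlim). intros n.
  pose (T := fun n => Cmod h ^ 2 * (K * exp (- (al * log_succ n)))).
  apply Rle_trans with (T O - T n).
  - apply psum_bound. intros j.
    assert (A : Cmod (z j) <= Cmod h ^ 2 * (K * (exp (- (al * log_succ j)) - exp (- (al * log_succ (S j)))))).
    { apply H; [apply log_succ_ge_0 | apply log_succ_le | lra | lra]. }
    rewrite Cmod_mult, Cmod_R.
    apply Rle_trans with (1 * Cmod (z j)).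
    + apply Rmult_le_compat_r; [apply Cmod_ge_0 | apply Hc].
    + unfold T. lra.
  - unfold T. rewrite T2. assert (A := T1 n).
    assert (P := Rmult_le_pos _ _ (pow2_ge_0 (Cmod h)) A).
    cbv beta in *. lra. }
rewrite Cmod_opp in HB. apply Rle_trans with (1 := HB).
apply (Rmult_lt_compat_r K) in h4; [ | exact HK].
replace (eps / K * K) with eps in h4 by (field; lra).
assert (A := Cmod_ge_0 h). nra.
Qed.

(** * Abel summation and the relation with zeta *)

(** For k >= 1 this is (m mod k) / k; division in [nat] provides the integer part. *)
Definition frac_div (k m : nat) : R := / INR k * INR m - INR (m / k).

Lemma frac_div_bound (k m : nat) : (1 <= k)%nat -> 0 <= frac_div k m <= 1.
Proof.
intros Hk. assert (Kp : 0 < INR k) by (apply lt_0_INR; lia).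
assert (A := Nat.div_mod_eq m k). assert (B := Nat.mod_upper_bound m k ltac:(lia)).
unfold frac_div. set (q := (m / k)%nat) in *. set (r := (m mod k)%nat) in *.
rewrite A, plus_INR, mult_INR.
replace (/ INR k * (INR k * INR q + INR r) - INR q) with (INR r / INR k) by (field; lra).
assert (C1 : INR r < INR k) by now apply lt_INR. assert (C2 := pos_INR r).
split; [now apply Rdiv_le_0_compat | ].
apply Rmult_le_reg_r with (1 := Kp). unfold Rdiv. rewrite Rmult_assoc, Rinv_l; lra.
Qed.

Lemma frac_div_mult (k m : nat) : (1 <= k)%nat -> frac_div k (k * m) = 0.
Proof.
intros Hk. assert (Kp : 0 < INR k) by (apply lt_0_INR; lia).
unfold frac_div. rewrite (Nat.mul_comm k m), Nat.div_mul, mult_INR by lia. field. lra.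
Qed.

Lemma pexp_log_mult (s : C) (k i : nat) : (1 <= k)%nat ->
  pexp s (log_succ (k * S i - 1)) = (pexp s (ln (INR k)) * pexp s (log_succ i))%C.
Proof.
intros Hk. unfold log_succ. replace (S (k * S i - 1)) with (k * S i)%nat by nia.
rewrite mult_INR, ln_mult; [ | apply lt_0_INR; lia | apply INR_S_pos].
unfold pexp. rewrite <- Cexp_plus. f_equal. rewrite RtoC_plus. ring.
Qed.

(** From m - 1 to m, [frac_div k] grows by 1/k, and falls by 1 as well when k divides m. The growth
    produces the first sum on the right; the falls, at m = k i with m^(-s) = k^(-s) i^(-s), produce
    the second. *)
Lemma abel_summation (k : nat) (s : C) (N : nat) : (1 <= k)%nat ->
  (psum (fun j => RtoC (frac_div k (S j)) * dirichlet_term s j) N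
   + RtoC (frac_div k N) * pexp s (log_succ N))%C =
  (RtoC (/ INR k) * psum (fun j => pexp s (log_succ j)) N
   - pexp s (ln (INR k)) * psum (fun j => pexp s (log_succ j)) (N / k))%C.
Proof.
intros Hk. assert (Kp : 0 < INR k) by (apply lt_0_INR; lia).
induction N as [ | N IH].
- rewrite Nat.Div0.div_0_l. simpl. unfold frac_div. rewrite Nat.Div0.div_0_l.
  rewrite Rmult_0_r, Rminus_0_r. ring.
- change (psum (fun j => RtoC (frac_div k (S j)) * dirichlet_term s j) (S N))%C with
    (psum (fun j => RtoC (frac_div k (S j)) * dirichlet_term s j) N
     + RtoC (frac_div k (S N)) * dirichlet_term s N)%C.
  change (psum (fun j => pexp s (log_succ j)) (S N)) with
    (psum (fun j => pexp s (log_succ j)) N + pexp s (log_succ N))%C.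
  unfold dirichlet_term at 2.
  set (A := psum (fun j => RtoC (frac_div k (S j)) * dirichlet_term s j)%C N) in *.
  set (P := psum (fun j => pexp s (log_succ j)) N) in *.
  assert (HN := Nat.div_mod_eq N k). assert (HS := Nat.div_mod_eq (S N) k).
  assert (BN := Nat.mod_upper_bound N k ltac:(lia)).
  assert (BS := Nat.mod_upper_bound (S N) k ltac:(lia)).
  assert (Hq : (S N / k = N / k \/ (S N / k = S (N / k) /\ S N = k * S (N / k)))%nat) by nia.
  assert (EA : A = (RtoC (/ INR k) * P - pexp s (ln (INR k)) *
    psum (fun j => pexp s (log_succ j)) (N / k) - RtoC (frac_div k N) * pexp s (log_succ N))%C).
  { rewrite <- IH. ring. }
  rewrite EA. destruct Hq as [E | [E E2]].
  + assert (F : frac_div k (S N) = frac_div k N + / INR k).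
    { unfold frac_div. rewrite E, S_INR. ring. }
    rewrite E, F, RtoC_plus. ring.
  + assert (F : frac_div k (S N) = frac_div k N + / INR k - 1).
    { unfold frac_div. rewrite E, (S_INR N), (S_INR (N / k)). ring. }
    assert (EP : pexp s (log_succ N) = (pexp s (ln (INR k)) * pexp s (log_succ (N / k)))%C).
    { rewrite <- pexp_log_mult by exact Hk. do 2 f_equal. lia. }
    rewrite E, F, RtoC_minus, RtoC_plus. simpl psum.
    set (B := psum (fun j => pexp s (log_succ j)) (N / k)) in *.
    rewrite EP. ring.
Qed.

(** The limit is taken along the multiples N = k M, where the boundary term of [abel_summation] is
    exactly 0 and N / k is M. *)
Lemma dirichlet_relation (k : nat) (s z d : C) : (1 <= k)%nat ->
  climit (psum (fun j => pexp s (log_succ j))) z ->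
  climit (psum (fun j => RtoC (frac_div k (S j)) * dirichlet_term s j)%C) d ->
  d = ((RtoC (/ INR k) - pexp s (ln (INR k))) * z)%C.
Proof.
intros Hk Hz Hd.
apply climit_unique with (fun M => psum (fun j => RtoC (frac_div k (S j)) * dirichlet_term s j)%C (k * M)%nat).
{ apply (climit_subseq (fun M => (k * M)%nat)) with (2 := Hd). intros M. nia. }
apply climit_ext with (fun M => RtoC (/ INR k) * psum (fun j => pexp s (log_succ j)) (k * M)%nat
  + - pexp s (ln (INR k)) * psum (fun j => pexp s (log_succ j)) M)%C.
{ intros M. assert (A := abel_summation k s (k * M) Hk).
  rewrite frac_div_mult in A by exact Hk.
  rewrite (Nat.mul_comm k M), Nat.div_mul, (Nat.mul_comm M k) in A by lia.
  transitivity (psum (fun j => RtoC (frac_div k (S j)) * dirichlet_term s j) (k * M)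
   + 0 * pexp s (log_succ (k * M)))%C; [rewrite A | ]; ring. }
replace ((RtoC (/ INR k) - pexp s (ln (INR k))) * z)%C with
  (RtoC (/ INR k) * z + - pexp s (ln (INR k)) * z)%C by ring.
apply climit_plus; apply climit_scal; [ | exact Hz].
apply (climit_subseq (fun M => (k * M)%nat)) with (2 := Hz). intros M. nia.
Qed.

Lemma cdiff_pexp (a : R) (s : C) : exists l, cdiff (fun w => pexp w a) s l.
Proof.
exists (pexp s a * - RtoC a)%C. intros eps Heps.
set (K := exp (- (Re s * a)) * (Rabs a ^ 2 * exp (Rabs a))).
assert (HK : 0 <= K).
{ unfold K. apply Rmult_le_pos; [ | apply Rmult_le_pos; [apply pow2_ge_0 | ]];
    apply Rlt_le, exp_pos. }
exists (Rmin 1 (eps / (1 + K))). split.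
{ apply Rmin_pos; [lra | apply Rdiv_lt_0_compat; lra]. }
intros w Hw. set (h := (w - s)%C) in *. assert (Ew : w = (s + h)%C) by (unfold h; ring).
clearbody h.
assert (h1 : Cmod h < 1) by (eapply Rlt_le_trans; [exact Hw | apply Rmin_l]).
assert (h2 : Cmod h < eps / (1 + K)) by (eapply Rlt_le_trans; [exact Hw | apply Rmin_r]).
assert (h0 := Cmod_ge_0 h).
assert (E : (pexp w a - pexp s a - pexp s a * - RtoC a * h)%C =
  (pexp s a * (Cexp (- h * RtoC a) - 1 - - h * RtoC a))%C).
{ replace (pexp w a) with (pexp s a * Cexp (- h * RtoC a))%C; [ring | ].
  unfold pexp. rewrite <- Cexp_plus. f_equal. rewrite Ew. ring. }
rewrite E, Cmod_mult, Cmod_pexp.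
assert (T := Cexp_taylor1_bound (- h * RtoC a)).
rewrite !Cmod_mult, Cmod_opp, Cmod_R in T.
apply Rle_trans with (Cmod h ^ 2 * K).
- unfold K. replace (Cmod h ^ 2 * (exp (- (Re s * a)) * (Rabs a ^ 2 * exp (Rabs a)))) with
    (exp (- (Re s * a)) * ((Cmod h * Rabs a) ^ 2 * exp (Rabs a))) by ring.
  apply Rmult_le_compat_l; [apply Rlt_le, exp_pos | ].
  apply Rle_trans with (1 := T). apply Rmult_le_compat_l; [apply pow2_ge_0 | ].
  assert (A : Cmod h * Rabs a <= Rabs a) by (assert (B := Rabs_pos a); nra).
  destruct A as [A | ->]; [ | lra]. now apply Rlt_le, exp_increasing.
- apply (Rmult_lt_compat_r (1 + K)) in h2; [ | lra].
  replace (eps / (1 + K) * (1 + K)) with eps in h2 by (field; lra).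
  replace (Cmod h ^ 2 * K) with (Cmod h * K * Cmod h) by ring.
  apply Rmult_le_compat_r; [exact h0 | lra].
Qed.

(** At height y, the strip of half-width |y| misses the real axis and with it the pole, so [h]
    vanishes at every nonreal point with positive real part. A real s other than 1 is reached by
    continuity of [h] from the points above it. *)
Lemma zero_kills_dirichlet (zeta : C -> C) (k : nat) (s : C) :
  is_riemann_zeta zeta -> (1 <= k)%nat -> 0 < Re s -> is_zero_of_zeta zeta s ->
  climit (psum (fun j => RtoC (frac_div k (S j)) * dirichlet_term s j)%C) 0%C.
Proof.
intros [_ Hhol Hser] Hk Hs [Hs1 Hz].
destruct (weighted_increment_series (fun j => frac_div k (S j))) as [D HD].
{ intros j. destruct (frac_div_bound k (S j) Hk). apply Rabs_le. lra. }
pose (h := fun w => ((RtoC (/ INR k) - pexp w (ln (INR k))) * zeta w - D w)%C).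
assert (Hdiff : forall w, 0 < Re w -> w <> RtoC 1 -> exists l, cdiff h w l).
{ intros w Hw Hw1. destruct (HD w Hw) as [_ [l Dl]].
  destruct (cdiff_pexp (ln (INR k)) w) as [m Dm].
  destruct (C_differentiable_cdiff zeta w (Hhol w Hw1)) as [n Dn].
  eexists. apply cdiff_minus; [ | exact Dl]. apply cdiff_mult; [ | exact Dn].
  apply cdiff_minus; [apply cdiff_const | exact Dm]. }
assert (Hbig : forall w, 1 < Re w -> h w = 0%C).
{ intros w Hw. unfold h. rewrite <- (dirichlet_relation k w (zeta w) (D w) Hk).
  - ring.
  - now apply is_series_climit, Hser.
  - apply HD. lra. }
assert (Hoff : forall x y, 0 < x -> y <> 0 -> h (x, y) = 0%C).
{ intros x y Hx Hy. apply (holomorphic_unique_continuation h 0 y (Rabs y)); try lra.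
  - now apply Rabs_pos_lt.
  - intros w Hw Hyw. apply Hdiff; [exact Hw | ]. intros ->. simpl in Hyw.
    destruct (Rcase_abs y); [rewrite Rabs_left in Hyw by lra | rewrite Rabs_right in Hyw by lra]; lra.
  - intros w Hw _. now apply Hbig. }
assert (Hh : h s = 0%C).
{ destruct s as [x y]. simpl in Hs.
  destruct (Req_dec y 0) as [-> | Ny]; [ | now apply Hoff].
  destruct (Hdiff (x, 0) Hs Hs1) as [l Hl].
  apply Cmod_eq_0. assert (P := Cmod_ge_0 (h (x, 0))).
  apply Rle_antisym; [ | exact P]. apply Rnot_lt_le. intro Q.
  destruct (cdiff_continuous h (x, 0) l Hl _ Q) as (d & Hd & Hd2).
  assert (E : ((x, (d / 2)%R) - (x, 0%R))%C = (RtoC (d / 2) * Ci)%C).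
  { unfold Cminus, Cplus, Copp, Cmult, RtoC, Ci; simpl. f_equal; ring. }
  specialize (Hd2 (x, d / 2)).
  rewrite E, Cmod_mult, Cmod_Ci, Cmod_R, Rabs_right, (Hoff x (d / 2)) in Hd2 by lra.
  replace (0 - h (x, 0))%C with (- h (x, 0))%C in Hd2 by ring.
  rewrite Cmod_opp in Hd2. lra. }
destruct (HD s Hs) as [Hlim _].
replace (RtoC 0) with (D s); [exact Hlim | ].
unfold h in Hh. rewrite Hz in Hh.
replace (D s) with (- ((RtoC (/ INR k) - pexp s (ln (INR k))) * 0 - D s))%C by ring.
rewrite Hh. ring.
Qed.

(** * The integral *)

Lemma IsStepFun_ext (f g : R -> R) (a b : R) : a <= b ->
  (forall x, a < x < b -> f x = g x) -> IsStepFun f a b -> IsStepFun g a b.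
Proof.
intros Hab E [l [lf (H1 & H2 & H3 & H4 & H5)]].
exists l, lf. split; [exact H1 | split; [exact H2 | split; [exact H3 | split; [exact H4 | ]]]].
intros i Hi x Hx. rewrite <- (H5 i Hi x Hx). symmetry. apply E.
rewrite Rmin_left in H2 by exact Hab. rewrite Rmax_right in H3 by exact Hab.
destruct Hx as [X1 X2]. split.
- apply Rle_lt_trans with (2 := X1). rewrite <- H2. apply RList.RList_P5; [exact H1 | ].
  apply RList.RList_P3. exists i. split; [reflexivity | lia].
- apply Rlt_le_trans with (1 := X2). rewrite <- H3. apply RList.RList_P7; [exact H1 | ].
  apply RList.RList_P3. exists (S i). split; [reflexivity | lia].
Qed.

Lemma RiemannInt_SF_ext (a b : R) (f g : StepFun a b) : a <= b ->
  (forall x, a < x < b -> f x = g x) -> RiemannInt_SF f = RiemannInt_SF g.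
Proof.
intros Hab E. apply Rle_antisym; apply StepFun_P37; try exact Hab;
  intros x Hx; rewrite (E x Hx); lra.
Qed.

(** The jumps of f_k accumulate at 0, so integrability there needs an argument: next to the endpoint
    the function is approximated by 0 with error M, at a cost M (e - a) that can be made at most eps
    / 2. *)
Lemma ex_RInt_bounded_at_left (f : R -> R) (a b B : R) : a < b ->
  (forall eps, 0 < eps -> exists e, a < e < a + eps /\ e <= b /\ ex_RInt f e b) ->
  (forall x, a < x <= b -> Rabs (f x) <= B) ->
  ex_RInt f a b.
Proof.
intros Hab Hint HB. apply ex_RInt_Reals_1. intros eps.
(* [B] bounds f only to the right of a, so the value at a is included. *)
set (M := Rmax (Rabs B) (Rabs (f a))).
assert (HM : 0 <= M) by (eapply Rle_trans; [apply Rabs_pos | apply Rmax_l]).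
assert (HfM : forall x, a <= x <= b -> Rabs (f x) <= M).
{ intros x Hx. destruct (Req_dec x a) as [-> | N]; [apply Rmax_r | ].
  apply Rle_trans with (1 := HB x ltac:(lra)).
  eapply Rle_trans; [apply Rle_abs | apply Rmax_l]. }
assert (Hd : 0 < eps / (2 * (M + 1))).
{ apply Rdiv_lt_0_compat; [apply cond_pos | lra]. }
destruct (constructive_indefinite_description _ (Hint _ Hd)) as [e (He1 & He2 & He3)].
apply ex_RInt_Reals_0 in He3.
destruct (He3 (pos_div_2 eps)) as [phi [psi [Hphi Hpsi]]].
rewrite Rmin_left, Rmax_right in Hphi by exact He2. simpl in Hpsi.
pose (phi' := fun x => if Rlt_dec x e then 0 else phi x).
pose (psi' := fun x => if Rlt_dec x e then M else psi x).
assert (Hl : forall c k x, a < x < e -> fct_cte c x = (if Rlt_dec x e then c else k x)).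
{ intros c k x Hx. destruct (Rlt_dec x e); [reflexivity | lra]. }
assert (Hr : forall c (k : R -> R) x, e < x < b -> k x = (if Rlt_dec x e then c else k x)).
{ intros c k x Hx. destruct (Rlt_dec x e); [lra | reflexivity]. }
assert (Sphi1 : IsStepFun phi' a e)
  by exact (IsStepFun_ext _ _ a e ltac:(lra) (Hl 0 phi) (StepFun_P4 a e 0)).
assert (Sphi2 : IsStepFun phi' e b)
  by exact (IsStepFun_ext _ _ e b ltac:(lra) (Hr 0 phi) (pre phi)).
assert (Spsi1 : IsStepFun psi' a e)
  by exact (IsStepFun_ext _ _ a e ltac:(lra) (Hl M psi) (StepFun_P4 a e M)).
assert (Spsi2 : IsStepFun psi' e b)
  by exact (IsStepFun_ext _ _ e b ltac:(lra) (Hr M psi) (pre psi)).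
exists (mkStepFun (StepFun_P46 Sphi1 Sphi2)), (mkStepFun (StepFun_P46 Spsi1 Spsi2)).
split.
- rewrite Rmin_left, Rmax_right by lra. intros t Ht. simpl. unfold phi', psi'.
  destruct (Rlt_dec t e).
  + rewrite Rminus_0_r. now apply HfM.
  + apply Hphi. lra.
- rewrite <- (StepFun_P43 Spsi1 Spsi2).
  rewrite (RiemannInt_SF_ext a e (mkStepFun Spsi1) (mkStepFun (StepFun_P4 a e M)))
    by (try lra; intros x Hx; symmetry; exact (Hl M psi x Hx)).
  rewrite (RiemannInt_SF_ext e b (mkStepFun Spsi2) psi)
    by (try lra; intros x Hx; symmetry; exact (Hr M psi x Hx)).
  rewrite StepFun_P18.
  assert (A : M * (e - a) <= eps / 2).
  { apply Rle_trans with ((M + 1) * (eps / (2 * (M + 1)))).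
    - apply Rmult_le_compat; lra.
    - apply Req_le. field. lra. }
  assert (A0 : 0 <= M * (e - a)) by (apply Rmult_le_pos; lra).
  apply Rabs_def2 in Hpsi. apply Rabs_def1; lra.
Qed.

Definition combination (n : nat) (lambda : nat -> R) (x : R) : R :=
  1 - sum_n_m (fun k => lambda k * fk k x) 2 n.

Definition combination_step (n : nat) (lambda : nat -> R) (j : nat) : R :=
  1 - sum_n_m (fun k => lambda k * frac_div k (S j)) 2 n.

(** Both floors depend only on [1/x] = j + 1, because [t/k] = [[t]/k]. *)
Lemma fk_step (k j : nat) (x : R) : (1 <= k)%nat ->
  / INR (S (S j)) < x < / INR (S j) -> fk k x = frac_div k (S j).
Proof.
intros Hk [X1 X2].
assert (Kp : 0 < INR k) by (apply lt_0_INR; lia).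
assert (J1 := INR_S_pos j). assert (J2 := INR_S_pos (S j)).
assert (Xp : 0 < x) by (apply Rlt_trans with (2 := X1); now apply Rinv_0_lt_compat).
assert (Y1 : INR (S j) < / x).
{ rewrite <- (Rinv_inv (INR (S j))). apply Rinv_lt_contravar; [ | exact X2].
  apply Rmult_lt_0_compat; [exact Xp | now apply Rinv_0_lt_compat]. }
assert (Y2 : / x < INR (S (S j))).
{ rewrite <- (Rinv_inv (INR (S (S j)))). apply Rinv_lt_contravar; [ | exact X1].
  apply Rmult_lt_0_compat; [now apply Rinv_0_lt_compat | exact Xp]. }
rewrite (S_INR (S j)) in Y2.
unfold fk, frac_div.
rewrite <- (Int_part_spec (/ x) (Z.of_nat (S j))) by (rewrite <- INR_IZR_INZ; lra).
rewrite <- (Int_part_spec (/ (INR k * x)) (Z.of_nat (S j / k))).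
- now rewrite <- !INR_IZR_INZ.
- rewrite <- INR_IZR_INZ. rewrite Rinv_mult.
  assert (A := Nat.div_mod_eq (S j) k). assert (B := Nat.mod_upper_bound (S j) k ltac:(lia)).
  set (q := (S j / k)%nat) in *.
  assert (C1 : INR k * INR q <= INR (S j)) by (rewrite <- mult_INR; apply le_INR; lia).
  assert (C2 : INR (S j) + 1 <= INR k * (INR q + 1)).
  { rewrite <- S_INR, <- (S_INR q), <- mult_INR. apply le_INR. lia. }
  assert (D1 : INR k * (/ INR k * / x) = / x) by (field; lra).
  split; apply Rmult_le_reg_l with (1 := Kp) || apply Rmult_lt_reg_l with (1 := Kp);
    rewrite ?Rmult_minus_distr_l, D1; lra.
Qed.

Lemma fk_bounded (k : nat) (x : R) : (1 <= k)%nat -> 0 < x -> Rabs (fk k x) <= 1.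
Proof.
intros Hk Hx.
assert (Kp : 0 < INR k) by (apply lt_0_INR; lia).
assert (K1 : 1 <= INR k) by (apply (le_INR 1 k); lia).
unfold fk. destruct (base_Int_part (/ x)) as [A1 A2].
destruct (base_Int_part (/ (INR k * x))) as [B1 B2].
rewrite Rinv_mult in *.
assert (Ki : 0 < / INR k <= 1).
{ split; [now apply Rinv_0_lt_compat | ]. rewrite <- Rinv_1. apply Rinv_le_contravar; lra. }
set (y := / x) in *. set (i := / INR k) in *.
set (p := IZR (Int_part y)) in *. set (q := IZR (Int_part (i * y))) in *.
assert (i * (y - 1) <= i * p) by (apply Rmult_le_compat_l; lra).
assert (i * p <= i * y) by (apply Rmult_le_compat_l; lra).
apply Rabs_le. lra.
Qed.

Lemma combination_step_eq (n : nat) (lambda : nat -> R) (j : nat) (x : R) :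
  / INR (S (S j)) < x < / INR (S j) -> combination n lambda x = combination_step n lambda j.
Proof.
intros Hx. unfold combination, combination_step. f_equal.
apply (sum_n_m_ext_loc (G := R_AbelianMonoid)). intros k Hk. rewrite (fk_step k j x); [reflexivity | lia | exact Hx].
Qed.

Lemma combination_bounded (n : nat) (lambda : nat -> R) : exists B, forall x, 0 < x ->
  Rabs (combination n lambda x) <= B.
Proof.
exists (1 + sum_n_m (fun k => Rabs (lambda k)) 2 n). intros x Hx.
unfold combination, Rminus. eapply Rle_trans; [apply Rabs_triang | ].
rewrite Rabs_R1, Rabs_Ropp. apply Rplus_le_compat_l.
eapply Rle_trans; [apply (norm_sum_n_m (V := R_NormedModule)) | ].
destruct (Nat.le_gt_cases 2 n) as [Hn | Hn].
2: { rewrite !sum_n_m_zero by lia. lra. }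
induction n as [ | n IH]; [lia | ].
destruct (Nat.eq_dec 2 (S n)) as [E | N].
- rewrite <- E, !sum_n_n. unfold norm; simpl. unfold abs; simpl. rewrite Rabs_mult.
  rewrite <- (Rmult_1_r (Rabs (lambda 2%nat))) at 2.
  apply Rmult_le_compat_l; [apply Rabs_pos | apply fk_bounded; [lia | exact Hx]].
- rewrite !(sum_n_Sm (G := R_AbelianMonoid)) by lia. apply Rplus_le_compat; [apply IH; lia | ].
  unfold norm; simpl. unfold abs; simpl. rewrite Rabs_mult.
  rewrite <- (Rmult_1_r (Rabs (lambda (S n)))) at 2.
  apply Rmult_le_compat_l; [apply Rabs_pos | apply fk_bounded; [lia | exact Hx]].
Qed.

(** The integral from 1/(N+1) to 1 of the square of the step function with value g j between 1/(j+2)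
    and 1/(j+1). *)
Fixpoint step_sq_sum (g : nat -> R) (N : nat) : R :=
  match N with
  | O => 0
  | S m => step_sq_sum g m + g m ^ 2 * (/ INR (S m) - / INR (S (S m)))
  end.

Lemma is_RInt_combination_sq (n : nat) (lambda : nat -> R) (N : nat) :
  is_RInt (fun x => combination n lambda x ^ 2) (/ INR (S N)) 1
    (step_sq_sum (combination_step n lambda) N).
Proof.
induction N as [ | N IH].
- simpl INR. rewrite Rinv_1. apply (is_RInt_point (V := R_NormedModule)).
- change (step_sq_sum (combination_step n lambda) (S N)) with
    (step_sq_sum (combination_step n lambda) N
     + combination_step n lambda N ^ 2 * (/ INR (S N) - / INR (S (S N)))).
  rewrite Rplus_comm.
  apply (is_RInt_Chasles (V := R_NormedModule)) with (2 := IH).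
  apply (is_RInt_ext (fun _ => combination_step n lambda N ^ 2)).
  + assert (A : / INR (S (S N)) < / INR (S N)).
    { apply Rinv_lt_contravar; [apply Rmult_lt_0_compat; apply INR_S_pos | apply lt_INR; lia]. }
    rewrite Rmin_left, Rmax_right by lra. intros x Hx.
    now rewrite (combination_step_eq n lambda N x Hx).
  + replace (combination_step n lambda N ^ 2 * (/ INR (S N) - / INR (S (S N)))) with
      (scal (/ INR (S N) - / INR (S (S N))) (combination_step n lambda N ^ 2)).
    * apply (is_RInt_const (V := R_NormedModule)).
    * apply Rmult_comm.
Qed.

Lemma ex_RInt_combination_sq (n : nat) (lambda : nat -> R) :
  ex_RInt (fun x => combination n lambda x ^ 2) 0 1.
Proof.
destruct (combination_bounded n lambda) as [B HB].
apply ex_RInt_bounded_at_left with (B ^ 2); [lra | | ].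
- intros eps Heps. destruct (archimed_cor1 eps Heps) as (N & HN & HN0).
  destruct N as [ | N]; [lia | ].
  exists (/ INR (S N)). assert (A := INR_S_pos N). split; [ | split].
  + split; [now apply Rinv_0_lt_compat | lra].
  + rewrite <- Rinv_1. apply Rinv_le_contravar; [lra | ]. apply (le_INR 1). lia.
  + eexists. apply is_RInt_combination_sq.
- intros x Hx. rewrite <- RPow_abs. apply pow_incr.
  split; [apply Rabs_pos | apply HB; lra].
Qed.

Lemma step_sq_sum_le_sq_dist (n : nat) (lambda : nat -> R) (N : nat) :
  step_sq_sum (combination_step n lambda) N <= sq_dist n lambda.
Proof.
assert (A := INR_S_pos N). assert (A1 : 0 < / INR (S N)) by now apply Rinv_0_lt_compat.
assert (A2 : / INR (S N) <= 1).
{ rewrite <- Rinv_1. apply Rinv_le_contravar; [lra | ]. apply (le_INR 1). lia. }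
assert (E := ex_RInt_combination_sq n lambda).
assert (E1 : ex_RInt (fun x => combination n lambda x ^ 2) 0 (/ INR (S N))).
{ apply (ex_RInt_Chasles_1 (V := R_CompleteNormedModule)) with 1; [lra | exact E]. }
change (sq_dist n lambda) with (RInt (fun x => combination n lambda x ^ 2) 0 1).
rewrite <- (RInt_Chasles (V := R_CompleteNormedModule) _ 0 (/ INR (S N)) 1).
- rewrite (is_RInt_unique _ _ _ _ (is_RInt_combination_sq n lambda N)).
  assert (P : 0 <= RInt (fun x => combination n lambda x ^ 2) 0 (/ INR (S N))).
  { apply RInt_ge_0; [lra | exact E1 | intros; apply pow2_ge_0]. }
  rewrite <- (Rplus_0_l (step_sq_sum _ _)) at 1. now apply Rplus_le_compat_r.
- exact E1.
- eexists. apply is_RInt_combination_sq.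
Qed.

(** * The Mellin transform of a combination and its bound *)

Lemma combination_series (s : C) (n : nat) (lambda : nat -> R) :
  (forall k, (2 <= k)%nat ->
    climit (psum (fun j => RtoC (frac_div k (S j)) * dirichlet_term s j)%C) 0%C) ->
  climit (psum (fun j =>
    RtoC (sum_n_m (fun k => (lambda k * frac_div k (S j))%R) 2 n) * dirichlet_term s j)%C) 0%C.
Proof.
intros H.
assert (Hz : forall m, (m < 2)%nat -> climit (psum (fun j =>
    RtoC (sum_n_m (fun k => (lambda k * frac_div k (S j))%R) 2 m) * dirichlet_term s j)%C) 0%C).
{ intros m Hm. apply climit_ext with (fun _ => 0%C); [ | apply climit_const].
  intros N. rewrite (psum_ext _ (fun j => 0 * 0)%C).
  - rewrite psum_scal. ring.
  - intros j. rewrite sum_n_m_zero by exact Hm. unfold zero; simpl. ring. }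
induction n as [ | n IH]; [apply Hz; lia | ].
destruct (Nat.le_gt_cases 2 (S n)) as [L | L]; [ | now apply Hz].
replace (RtoC 0) with (0 + RtoC (lambda (S n)) * 0)%C by ring.
apply climit_ext with (fun N =>
  psum (fun j => RtoC (sum_n_m (fun k => (lambda k * frac_div k (S j))%R) 2 n) * dirichlet_term s j)%C N
  + RtoC (lambda (S n)) * psum (fun j => RtoC (frac_div (S n) (S j)) * dirichlet_term s j)%C N)%C.
- intros N. rewrite <- psum_scal, <- psum_plus. apply psum_ext. intros j.
  rewrite (sum_n_Sm (G := R_AbelianMonoid)) by lia.
  unfold plus; cbn -[INR]. rewrite RtoC_plus, RtoC_mult. ring.
- apply climit_plus; [exact IH | apply climit_scal, H, L].
Qed.

(** The Mellin transform of the constant 1, up to the factor s: the partial sums are 1 -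
    (N+1)^(-s). *)
Lemma dirichlet_term_telescope (s : C) : 0 < Re s -> climit (psum (dirichlet_term s)) 1%C.
Proof.
intros Hs.
assert (E : forall N, psum (dirichlet_term s) N = (1 - pexp s (log_succ N))%C).
{ induction N as [ | N IH].
  - simpl. rewrite log_succ_0. unfold pexp. rewrite Cmult_0_r, Cexp_0. ring.
  - simpl psum. rewrite IH. unfold dirichlet_term. ring. }
intros eps Heps.
destruct (INR_unbounded (exp (- ln eps / Re s))) as [N HN].
exists N. intros n Hn. rewrite E.
replace (1 - pexp s (log_succ n) - 1)%C with (- pexp s (log_succ n))%C by ring.
rewrite Cmod_opp, Cmod_pexp. rewrite <- (exp_ln eps) by exact Heps.
apply exp_increasing.
assert (A : - ln eps / Re s < log_succ n).
{ unfold log_succ. rewrite <- (ln_exp (- ln eps / Re s)). apply ln_increasing; [apply exp_pos | ].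
  apply Rlt_le_trans with (1 := HN). apply le_INR. lia. }
apply (Rmult_lt_compat_l (Re s)) in A; [ | exact Hs].
replace (Re s * (- ln eps / Re s)) with (- ln eps) in A by (field; lra). lra.
Qed.

(* The pointwise inequality 2 |g| x^(sigma-1) <= tau g^2 + x^(2 sigma-2) / tau,
   integrated over (1/(j+2), 1/(j+1)] in the variable y = ln (1/x). *)
Lemma weighted_term_bound (s : C) (g tau : R) (j : nat) :
  0 < tau -> 0 < 2 * Re s - 1 ->
  Cmod (RtoC g * dirichlet_term s j) <=
    Cmod s / 2 * tau * (g ^ 2 * (/ INR (S j) - / INR (S (S j)))) +
    Cmod s / (2 * tau * (2 * Re s - 1)) *
      (exp (- ((2 * Re s - 1) * log_succ j)) - exp (- ((2 * Re s - 1) * log_succ (S j)))).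
Proof.
intros Ht Hb. set (be := 2 * Re s - 1) in *.
rewrite <- !exp_opp_log_succ.
pose (G := fun y => - (Cmod s / 2 * tau * g ^ 2) * exp (- y)
  - Cmod s / (2 * tau * be) * exp (- (be * y))).
replace (Cmod s / 2 * tau * (g ^ 2 * (exp (- log_succ j) - exp (- log_succ (S j)))) +
  Cmod s / (2 * tau * be) * (exp (- (be * log_succ j)) - exp (- (be * log_succ (S j)))))
  with (G (log_succ (S j)) - G (log_succ j)) by (unfold G; ring).
replace (RtoC g * dirichlet_term s j)%C with
  (RtoC (- g) * pexp s (log_succ (S j)) - RtoC (- g) * pexp s (log_succ j))%C
  by (unfold dirichlet_term; rewrite RtoC_opp; ring).
apply (dominated_increment (fun y => RtoC (- g) * pexp s y)%C
  (fun y => RtoC (- g) * (- s * pexp s y))%C G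
  (fun y => Cmod s / 2 * (tau * g ^ 2 * exp (- y) + exp (- (be * y)) / tau))).
- apply log_succ_le.
- intros x _. eapply cderiv_eq.
  + apply cderiv_mult; [apply cderiv_const | apply pexp_cderiv].
  + cbv beta. ring.
- intros x _. unfold G. auto_derive; [trivial | ]. field. lra.
- intros x _. rewrite !Cmod_mult, Cmod_R, Cmod_opp, Cmod_pexp, Rabs_Ropp.
  (* As 2 Re s = 1 + be, the modulus exp (- Re s x) splits into A B; [K] is then (tau |g| A - B)^2 /
     tau >= 0 expanded. *)
  set (A := exp (- x / 2)). set (B := exp (- (be * x) / 2)).
  assert (E1 : exp (- x) = A * A) by (unfold A; rewrite <- exp_plus; f_equal; field).
  assert (E2 : exp (- (be * x)) = B * B) by (unfold B; rewrite <- exp_plus; f_equal; field).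
  assert (E3 : exp (- (Re s * x)) = A * B).
  { unfold A, B. rewrite <- exp_plus. f_equal. unfold be. field. }
  rewrite E1, E2, E3.
  assert (K : 2 * Rabs g * (A * B) <= tau * g ^ 2 * (A * A) + B * B / tau).
  { rewrite <- (pow2_abs g).
    assert (S : 0 <= (tau * Rabs g * A - B) ^ 2 / tau).
    { apply Rdiv_le_0_compat; [apply pow2_ge_0 | exact Ht]. }
    replace ((tau * Rabs g * A - B) ^ 2 / tau) with
      (tau * Rabs g ^ 2 * (A * A) + B * B / tau - 2 * Rabs g * (A * B)) in S by (field; lra).
    lra. }
  assert (P := Cmod_ge_0 s).
  apply Rle_trans with (Cmod s / 2 * (2 * Rabs g * (A * B))).
  + apply Req_le. field.
  + apply Rmult_le_compat_l; lra.
Qed.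

Lemma weighted_psum_bound (s : C) (g : nat -> R) (tau : R) (N : nat) :
  0 < tau -> 0 < 2 * Re s - 1 ->
  Cmod (psum (fun j => RtoC (g j) * dirichlet_term s j)%C N) <=
    Cmod s / 2 * tau * step_sq_sum g N + Cmod s / (2 * tau * (2 * Re s - 1)).
Proof.
intros Ht Hb. set (c := Cmod s / (2 * tau * (2 * Re s - 1))).
assert (Hc : 0 <= c).
{ apply Rdiv_le_0_compat; [apply Cmod_ge_0 | ]. apply Rmult_lt_0_compat; lra. }
(* The induction has to keep the telescoped exponential; it is dropped only afterwards. *)
enough (H : Cmod (psum (fun j => RtoC (g j) * dirichlet_term s j)%C N) <=
  Cmod s / 2 * tau * step_sq_sum g N + c * (1 - exp (- ((2 * Re s - 1) * log_succ N)))).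
{ apply Rle_trans with (1 := H). apply Rplus_le_compat_l.
  assert (A := exp_pos (- ((2 * Re s - 1) * log_succ N))). nra. }
induction N as [ | N IH].
- change (Cmod 0 <= Cmod s / 2 * tau * 0 + c * (1 - exp (- ((2 * Re s - 1) * log_succ 0)))).
  rewrite Cmod_0, log_succ_0.
  replace (- ((2 * Re s - 1) * 0)) with 0 by ring. rewrite exp_0. lra.
- assert (A := weighted_term_bound s (g N) tau N Ht Hb). fold c in A.
  simpl psum. eapply Rle_trans; [apply Cmod_triangle | ].
  change (step_sq_sum g (S N)) with
    (step_sq_sum g N + g N ^ 2 * (/ INR (S N) - / INR (S (S N)))).
  lra.
Qed.

Lemma sq_dist_0 (n : nat) : sq_dist n (fun _ => 0) = 1.
Proof.
unfold sq_dist. rewrite (RInt_ext _ (fun _ => 1)).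
- rewrite RInt_const. unfold scal; simpl; unfold mult; simpl. ring.
- intros x _. rewrite (sum_n_m_ext (G := R_AbelianMonoid) _ (fun _ => zero)).
  + rewrite sum_n_m_const_zero. unfold zero; simpl. ring.
  + intros k. apply Rmult_0_l.
Qed.

Theorem theorem3 (zeta : C -> C) (Hzeta : is_riemann_zeta zeta)
  (n : nat) (Hn : (2 <= n)%nat)
  (d : R) (Hd0 : 0 <= d) (Hd : is_min_value (sq_dist n) (d ^ 2)) :
  forall s : C, (1 + d * Cmod s ^ 2) / 2 < Re s -> ~ is_zero_of_zeta zeta s.
Proof.
intros s Hs Hzero.
destruct Hd as [[lambda Hlam] Hmin].
assert (Hd1 : d ^ 2 <= 1) by (rewrite <- (sq_dist_0 n); apply Hmin).
assert (HS2 := pow2_ge_0 (Cmod s)).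
assert (Hds : 0 <= d * Cmod s ^ 2) by now apply Rmult_le_pos.
set (be := 2 * Re s - 1).
assert (Hbe : d * Cmod s ^ 2 < be) by (unfold be; lra).
assert (HC : 0 < Cmod s).
{ assert (A := re_le_Cmod s). assert (B := Rle_abs (Re s)). lra. }
assert (Hlim : climit (psum (fun j => RtoC (combination_step n lambda j) * dirichlet_term s j)%C) 1%C).
{ replace (RtoC 1) with (1 + (-1) * 0)%C by ring.
  apply climit_ext with (fun N => psum (dirichlet_term s) N + (-1) * psum (fun j =>
    RtoC (sum_n_m (fun k => (lambda k * frac_div k (S j))%R) 2 n) * dirichlet_term s j)%C N)%C.
  - intros N. rewrite <- psum_scal, <- psum_plus. apply psum_ext. intros j.
    unfold combination_step. rewrite RtoC_minus. ring.
  - apply climit_plus; [apply dirichlet_term_telescope; lra | ].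
    apply climit_scal, combination_series. intros k Hk.
    apply (zero_kills_dirichlet zeta); [exact Hzeta | lia | lra | exact Hzero]. }
(* With tau = |s| / be the second term of the bound is exactly 1/2, and what remains says be <= d^2
   |s|^2. The minimising tau would be 1 / (d sqrt be), which agrees with this one in the critical
   case be = d^2 |s|^2 but makes no sense for d = 0. *)
assert (Htau : 0 < Cmod s / be) by (apply Rdiv_lt_0_compat; lra).
assert (B : Cmod 1 <= Cmod s / 2 * (Cmod s / be) * d ^ 2 + Cmod s / (2 * (Cmod s / be) * be)).
{ apply climit_bound with (2 := Hlim). intros N.
  eapply Rle_trans; [apply (weighted_psum_bound s _ (Cmod s / be)); [exact Htau | fold be; lra] | ].
  fold be. apply Rplus_le_compat_r. apply Rmult_le_compat_l.
  - apply Rmult_le_pos; lra.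
  - rewrite <- Hlam. apply step_sq_sum_le_sq_dist. }
rewrite Cmod_1 in B.
replace (Cmod s / 2 * (Cmod s / be) * d ^ 2 + Cmod s / (2 * (Cmod s / be) * be)) with
  ((d ^ 2 * Cmod s ^ 2 / be + 1) / 2) in B by (field; lra).
assert (D : d ^ 2 * Cmod s ^ 2 < be).
{ assert (Hdle : d ^ 2 <= d) by nra.
  apply Rle_lt_trans with (2 := Hbe). now apply Rmult_le_compat_r. }
apply (Rmult_lt_compat_r (/ be)) in D; [ | apply Rinv_0_lt_compat; lra].
rewrite Rinv_r in D by lra. unfold Rdiv in B at 2. lra.
Qed.
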